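(* Let $n\ge2$, $1\le p<n$, $\tau\in[-1,1]$ and let $K$ be a compact set in $\mathbb{R}^n$. Then $$C_{p,\tau}(K)=\inf_{f\in\mathcal{D}(K)}\mathcal{H}_{p,\tau}(f),$$ where $\mathcal{D}(K)=\{f\in W_0^{1,p}:\ f\ge1\text{ on }K\}$.
   Context: $W_0^{1,p}$ is the closure of $C_c^\infty(\mathbb{R}^n)$ under the norm $\|f\|_{1,p}=\|f\|_p+\|\nabla f\|_p$ ($\nabla f$ being the weak gradient). $du$ is the rotation-invariant probability measure on $S^{n-1}$. For $\tau\in[-1,1]$ let $\varphi_\tau(t)=\big(\tfrac{1+\tau}{2}\big)^{1/p}t_++\big(\tfrac{1-\tau}{2}\big)^{1/p}t_-$, with $t_+=\max\{t,0\}$, $t_-=\max\{-t,0\}$. For $f\in W_0^{1,p}$ let $$\mathcal{H}_{p,\tau}(f)=\Big(\int_{S^{n-1}}\Big(\int_{\mathbb{R}^n}[\varphi_\tau(u\cdot\nabla f(x))]^p\,dx\Big)^{-n/p}du\Big)^{-p/n}$$ (with conventions $1/0=\infty$, $1/\infty=0$, so that $\mathcal{H}_{p,\tau}(0)=0$). The general $p$-affine capacity of a compact set $K\subset\mathbb{R}^n$ is defined here by $$C_{p,\tau}(K)=\inf_{f\in\mathcal{E}(K)}\mathcal{H}_{p,\tau}(f),\qquad \mathcal{E}(K)=\{f\in W_0^{1,p}:\ f\ge\mathbf{1}_K\},$$ where $\mathbf{1}_K$ is the indicator function of $K$. The inequalities in the definitions of $\mathcal{E}(K)$ and $\mathcal{D}(K)$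 are understood in the same sense. *)

(* Defs.v *)
From HB Require Import structures.
From mathcomp Require Import all_boot all_order all_algebra.
From mathcomp Require Import all_classical all_reals all_analysis.
From mathcomp Require Import measurable_realfun.

Set Implicit Arguments.
Unset Strict Implicit.
Unset Printing Implicit Defensive.

Import Order.TTheory GRing.Theory Num.Theory.
Import numFieldNormedType.Exports.

Local Open Scope classical_set_scope.
Local Open Scope ring_scope.


Definition mx_display : measure_display.
Proof. exact: default_measure_display. Qed.

Section borel_matrix.
Context (R : realType) (m n : nat).

Definition borel_mx : set (set 'M[R]_(m, n)) := <<s @open 'M[R]_(m, n) >>.

Let borel_mx0 : borel_mx set0.
Proof. exact: sigma_algebra0. Qed.

Let borel_mxC (A : set 'M[R]_(m, n)) : borel_mx A -> borel_mx (~` A).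
Proof. exact: sigma_algebraC. Qed.

Let borel_mx_bigcup (F : (set 'M[R]_(m, n))^nat) :
  (forall i, borel_mx (F i)) -> borel_mx (\bigcup_i F i).
Proof. exact: sigma_algebra_bigcup. Qed.

HB.instance Definition _ := @isMeasurable.Build mx_display 'M[R]_(m, n)
  borel_mx borel_mx0 borel_mxC borel_mx_bigcup.

End borel_matrix.

Section borel_theory.
Context (R : realType).

Lemma open_measurable_mx m n (U : set 'M[R]_(m, n)) : open U -> measurable U.
Proof. exact: sub_sigma_algebra. Qed.

Lemma measurable_coord m n i j :
  measurable_fun setT (fun x : 'M[R]_(m, n) => x i j).
Proof.
apply: (measurability _ (RGenOInfty.measurableE R)).
move=> _ [_ [a ->] <-]; rewrite setTI; apply: open_measurable_mx.
by apply: open_comp; [move=> x _; exact: coord_continuous|exact: interval_open].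
Qed.

(* The Borel sets are generated by the coordinates. *)
Lemma measurable_fun_mx d (T : measurableType d) m n (f : T -> 'M[R]_(m, n)) :
  (forall i j, measurable_fun setT (fun t => f t i j)) -> measurable_fun setT f.
Proof.
move=> mf; apply: (measurability _ (erefl : measurable = <<s @open 'M[R]_(m, n) >>)).
move=> _ [U oU <-]; rewrite setTI.
pose B (q : 'M[rat]_(m, n) * nat) : set 'M[R]_(m, n) :=
  ball (map_mx ratr q.1 : 'M[R]_(m, n)) q.2.+1%:R^-1.
have mB q : measurable (f @^-1` B q).
  have -> : f @^-1` B q = \bigcap_(ij : 'I_m * 'I_n)
      ((fun t => f t ij.1 ij.2) @^-1`
         ball (ratr (q.1 ij.1 ij.2) : R) q.2.+1%:R^-1).
    apply/seteqP; split => [t [_ Bt] [i j] _ /=|t Bt].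
      by have := Bt i j; rewrite mxE.
    split=> [|i j]; first by rewrite invr_gt0.
    by rewrite mxE; exact: (Bt (i, j)).
  apply: fin_bigcap_measurable => // -[i j] _ /=.
  rewrite -[X in measurable X]setTI; apply: mf => //.
  by apply: open_measurable; exact: ball_open.
rewrite (_ : f @^-1` U = \bigcup_(q in [set q | B q `<=` U]) f @^-1` B q).
  rewrite bigcup_mkcond; apply: countable_bigcupT_measurable => [|q].
    exact: countableP.
  by case: ifPn => _; [exact: mB|exact: measurable0].
apply/seteqP; split => [t Ut|t [q qU] /qU//].
have /nbhs_ballP[e /= e0 eU] : nbhs (f t) U by apply: open_nbhs_nbhs.
have [k ke] : exists k, k.+1%:R^-1 < e / 2.
  have e20 : 0 < e / 2 by rewrite divr_gt0.
  have [k _ H] := near_infty_natSinv_lt (PosNum e20).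
  by exists k; exact: (H k (leqnn k)).
have kP : (0 : R) < k.+1%:R^-1 by rewrite invr_gt0.
pose q := \matrix_(i, j) xget 0
  [set r : rat | `|f t i j - ratr r| < k.+1%:R^-1] : 'M[rat]_(m, n).
have qP i j : `|f t i j - ratr (q i j)| < k.+1%:R^-1.
  rewrite mxE; case: xgetP => [r -> //|/(_ _)].
  have /rat_in_itvoo[r] : f t i j - k.+1%:R^-1 < f t i j + k.+1%:R^-1.
    by rewrite ltrD2l gtrN.
  by rewrite in_itv/= => rP /(_ r); rewrite -/(_ < _) ltr_distlC rP.
exists (q, k).
  move=> y [_ By]; apply: eU; split => // i j.
  have := By i j; rewrite mxE /ball/= => yq.
  have -> : f t i j - y i j = (f t i j - ratr (q i j)) + (ratr (q i j) - y i j).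
    by rewrite addrA subrK.
  rewrite (le_lt_trans (ler_normD _ _))// (splitr e) ltrD//.
    exact: lt_trans (qP i j) ke.
  exact: lt_trans yq ke.
split => // i j; rewrite mxE /ball/= distrC; exact: qP.
Qed.

End borel_theory.

Section lebesgue_measure_rV.
Context (R : realType).

Definition cons_row n (tx : R * 'rV[R]_n) : 'rV[R]_n.+1 :=
  row_mx (tx.1)%:M tx.2 : 'rV[R]_(1 + n).

Lemma cons_rowE n (tx : R * 'rV[R]_n) i j :
  cons_row tx i j = if unlift ord0 j is Some k then tx.2 ord0 k else tx.1.
Proof.
rewrite /cons_row ord1; case: unliftP => [k ->|->].
  have -> : lift ord0 k = rshift 1 k by apply: val_inj.
  exact: (row_mxEr (tx.1)%:M tx.2).
have -> : ord0 = lshift n (ord0 : 'I_1) by apply: val_inj.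
by apply: etrans (row_mxEl (tx.1)%:M tx.2 _ _) _; rewrite mxE eqxx mulr1n.
Qed.

Lemma measurable_cons_row n : measurable_fun setT (@cons_row n).
Proof.
apply: measurable_fun_mx => i j; under eq_fun do rewrite cons_rowE.
case: unliftP => [k _|_]; last exact: measurable_fst.
exact: measurableT_comp (measurable_coord _ _) measurable_snd.
Qed.

Definition uncons_row n (x : 'rV[R]_n.+1) : R * 'rV[R]_n :=
  (x ord0 ord0, \row_j x ord0 (lift ord0 j)).

Lemma uncons_rowK n : cancel (@uncons_row n) (@cons_row n).
Proof.
move=> x; apply/rowP => j; rewrite cons_rowE/=.
by case: unliftP => [k ->|-> //]; rewrite mxE.
Qed.

Lemma cons_rowK n : cancel (@cons_row n) (@uncons_row n).
Proof.
move=> [t x]; congr pair; first by rewrite cons_rowE unlift_none.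
by apply/rowP => j; rewrite mxE cons_rowE liftK.
Qed.

Lemma measurable_uncons_row n : measurable_fun setT (@uncons_row n).
Proof.
apply/measurable_fun_pairP; split; first exact: measurable_coord.
apply: measurable_fun_mx => i j; under eq_fun do rewrite mxE.
exact: measurable_coord.
Qed.

Definition lebesgueS n (mu : {sigma_finite_measure set 'rV[R]_n -> \bar R}) :
    set 'rV[R]_n.+1 -> \bar R :=
  pushforward (@lebesgue_measure R \x mu)%E (@cons_row n).

Section lebesgueS_measure.
Context (n : nat) (mu : {sigma_finite_measure set 'rV[R]_n -> \bar R}).

Let lebesgueS0 : lebesgueS mu set0 = 0%E.
Proof. by rewrite /lebesgueS /pushforward preimage_set0 measure0. Qed.

Let lebesgueS_ge0 A : (0 <= lebesgueS mu A)%E.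
Proof. by rewrite /lebesgueS /pushforward measure_ge0. Qed.

Let lebesgueS_additive : semi_sigma_additive (lebesgueS mu).
Proof.
move=> F mF tF mUF; rewrite /lebesgueS /pushforward preimage_bigcup.
apply: measure_semi_sigma_additive.
- by move=> k; rewrite -[X in measurable X]setTI; exact: measurable_cons_row.
- apply/trivIsetP => /= i j _ _ ij; rewrite -preimage_setI.
  by move/trivIsetP : tF => /(_ _ _ _ _ ij) ->//; rewrite preimage_set0.
- by rewrite -preimage_bigcup -[X in measurable X]setTI; exact: measurable_cons_row.
Qed.

HB.instance Definition _ := isMeasure.Build _ _ _ (lebesgueS mu)
  lebesgueS0 lebesgueS_ge0 lebesgueS_additive.

Let lebesgueS_sigma_finite : sigma_finite setT (lebesgueS mu).
Proof.
have /sigma_finiteP[F [TF ndF Foo]] := sigma_finiteT (@lebesgue_measure R).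
have /sigma_finiteP[G [TG ndG Goo]] := sigma_finiteT mu.
exists (fun k => @uncons_row n @^-1` (F k `*` G k)).
  apply/esym; rewrite -subTset => x _; set tx := uncons_row x.
  have [k _ Fk] : (\bigcup_k F k) tx.1 by rewrite -TF.
  have [l _ Gl] : (\bigcup_l G l) tx.2 by rewrite -TG.
  exists (maxn k l) => //; split.
  - by move: Fk; exact/subsetPset/ndF/leq_maxl.
  - by move: Gl; exact/subsetPset/ndG/leq_maxr.
move=> k; have [mF Fk] := Foo k; have [mG Gk] := Goo k; split.
  rewrite -[X in measurable X]setTI; apply: measurable_uncons_row => //.
  exact: measurableX.
rewrite /lebesgueS /pushforward -comp_preimage.
rewrite (_ : _ \o _ = id) ?preimage_id; last first.
  by apply/funext => x /=; rewrite cons_rowK.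
by rewrite product_measure1E// lte_mul_pinfty// ge0_fin_numE.
Qed.

HB.instance Definition _ := Measure_isSigmaFinite.Build _ _ _ (lebesgueS mu)
  lebesgueS_sigma_finite.

End lebesgueS_measure.

(* Lebesgue measure on R^n, as the n-fold product of the Lebesgue measure on
   R; the measure on R^0 is the unit mass at its only point. *)
Fixpoint lebesgue n : {sigma_finite_measure set 'rV[R]_n -> \bar R} :=
  match n with
  | 0 => @dirac _ 'rV[R]_0 0 R
  | k.+1 => lebesgueS (lebesgue k)
  end.

End lebesgue_measure_rV.


Section sobolev.
Context (R : realType) (n : nat).
Local Notation V := 'rV[R]_n.
Local Notation lambda := (lebesgue R n).

(* The library norm `|v| on 'rV[R]_n is the sup norm, hence the definitions of
   the Euclidean scalar product and norm. *)
Definition dotv (u v : V) : R := \sum_(i < n) u ord0 i * v ord0 i.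

Definition enorm (v : V) : R := Num.sqrt (dotv v v).

Definition partial (i : 'I_n) (f : V -> R) : V -> R :=
  'D_(delta_mx ord0 i) f.

Definition grad (f : V -> R) (x : V) : V := \row_i partial i f x.

Fixpoint Ck (k : nat) (f : V -> R) : Prop :=
  continuous f /\
  if k is l.+1 then
    forall i, (forall x, derivable f x (delta_mx ord0 i)) /\ Ck l (partial i f)
  else True.

Definition Cc_infty : set (V -> R) :=
  [set phi | (forall k, Ck k phi) /\ compact (closure [set x | phi x != 0])].

Definition locally_integrable_rV (f : V -> R) : Prop :=
  forall A : set V, compact A -> lambda.-integrable A (EFin \o f).

Definition weak_gradient (f : V -> R) (g : V -> V) : Prop :=
  [/\ locally_integrable_rV f,
      forall i, locally_integrable_rV (fun x => g x ord0 i) &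
      forall phi, Cc_infty phi -> forall i,
        \int[lambda]_x (f x * partial i phi x) =
        - \int[lambda]_x (g x ord0 i * phi x)].

(* A weakly differentiable function, together with its weak gradient (which is
   unique up to a null set). *)
Record wdiff := WDiff {
  wfun :> V -> R;
  wgrad : V -> V;
  wdiffP : weak_gradient wfun wgrad }.

(* ||f||_{1,p}, for f with weak gradient g *)
Definition sobolev_norm (p : R) (f : V -> R) (g : V -> V) : \bar R :=
  (Lnorm lambda p%:E (EFin \o f)
   + Lnorm lambda p%:E (fun x => (enorm (g x))%:E))%E.

Definition W01p (p : R) : set wdiff :=
  [set f : wdiff | forall eps : R, 0 < eps -> exists2 phi, Cc_infty phi &
    (sobolev_norm p (f \- phi)%R (wgrad f \- grad phi)%R < eps%:E)%E].

End sobolev.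


Section capacity.
Context (R : realType) (n : nat).
Local Notation V := 'rV[R]_n.
Local Notation lambda := (lebesgue R n).

Definition unit_sphere : set V := [set u | enorm u = 1].

Definition is_rotation (Q : 'M[R]_n) : Prop := Q *m Q^T = 1%:M /\ \det Q = 1.

Definition rotation_invariant_sphere (sigma : probability V R) : Prop :=
  sigma unit_sphere = 1%E /\
  forall Q, is_rotation Q -> forall A, measurable A ->
    sigma ((fun u => u *m Q) @^-1` A) = sigma A.

Definition phi_tau (p tau t : R) : R :=
  ((1 + tau) / 2) `^ p^-1 * Num.max t 0
  + ((1 - tau) / 2) `^ p^-1 * Num.max (- t) 0.

(* x to the power -s. The library inverse on \bar R satisfies 0^-1 = +oo and
   +oo^-1 = 0, whereas its power gives 0 to 0 to any nonzero exponent, even a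
   negative one, and +oo to +oo. *)
Definition poweRV (x : \bar R) (s : R) : \bar R := ((poweR x s)^-1)%E.

Definition calH (sigma : probability V R) (p tau : R) (f : wdiff R n) : \bar R :=
  let I u := (\int[lambda]_x (phi_tau p tau (dotv u (wgrad f x)) `^ p)%:E)%E in
  poweRV (\int[sigma]_(u in unit_sphere) poweRV (I u) (n%:R / p))%E (p / n%:R).

(* Elements of W_0^{1,p} are classes of functions modulo null sets: the
   inequalities hold almost everywhere. *)
Definition calE (p : R) (K : set V) : set (wdiff R n) :=
  [set f : wdiff R n | W01p p f /\ {ae lambda, forall x, \1_K x <= f x}].

Definition calD (p : R) (K : set V) : set (wdiff R n) :=
  [set f : wdiff R n | W01p p f /\ {ae lambda, forall x, K x -> 1 <= f x}].

Definition capacity (sigma : probability V R) (p tau : R) (K : set V) : \bar R :=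
  ereal_inf [set calH sigma p tau f | f in calE p K].

End capacity.

(* Main.v *)
(* Replacing f in D(K) by its positive part F yields an element of E(K), and
   since the weak gradient of F is c(x) * grad f(x) with 0 <= c(x) <= 1, the
   energy does not increase.  That F is in W_0^{1,p} is seen by approximating it
   with ramp_d(phi), where phi in C_c^infty approximates f and
   ramp_d(t) = (sqrt(t^2 + d^2) + t - d) / 2 is smooth, 1-Lipschitz and vanishes
   at 0.  With psi another approximation of f,
     c(f) grad f - ramp_d'(phi) grad phi =
       (c(f) - ramp_d'(f)) grad f
       + (ramp_d'(f) - ramp_d'(phi)) (grad f - grad psi)
       + (ramp_d'(f) - ramp_d'(phi)) grad psi
       + ramp_d'(phi) (grad f - grad phi),
   and one chooses psi first, then d (by dominated convergence in the first
   term), and phi last (grad psi being bounded).  A function that is W^{1,p}-close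
   to C_c^infty functions is weakly differentiable because these satisfy
   integration by parts. *)
Require Import Defs.
From HB Require Import structures.
From mathcomp Require Import all_boot all_order all_algebra.
From mathcomp Require Import all_classical all_reals all_analysis.
From mathcomp Require Import measurable_realfun ring lra.
Import Order.TTheory GRing.Theory Num.Theory.
Import numFieldNormedType.Exports.
Local Open Scope classical_set_scope.
Local Open Scope ring_scope.

Set Implicit Arguments.
Unset Strict Implicit.

(** * Lebesgue measure on R^n *)

Section lebesgue_rV.
Context (R : realType).

Lemma measurable_continuous_mx m n (f : 'M[R]_(m, n) -> R) :
  continuous f -> measurable_fun setT f.
Proof.
move=> cf; apply: (measurability _ (RGenOInfty.measurableE R)).
move=> _ [_ [a ->] <-]; rewrite setTI; apply: open_measurable_mx.
by apply: open_comp; [move=> x _; exact: cf|exact: interval_open].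
Qed.

(** For M >= 0 this is a closed ball of the sup norm. Being a product of intervals, it is compact
    and its measure is accessible by induction on the dimension; in dimension 0 it is the whole
    space whatever M is. *)
Definition cube n (M : R) : set 'rV[R]_n := [set x | forall i, `|x ord0 i| <= M].
Arguments cube : clear implicits.

Lemma compact_cube n (M : R) : compact (cube n M).
Proof.
have -> : cube n M = [set v | forall i, `[- M, M]%classic (v ord0 i)].
  by apply/seteqP; split => x xM i; have := xM i; rewrite /= in_itv/= ler_norml.
apply: (@rV_compact R n (fun=> `[- M, M]%classic)) => _.
exact: segment_compact.
Qed.

Lemma measurable_compact_mx m n (A : set 'M[R]_(m, n)) : compact A -> measurable A.
Proof.
move=> cptA; have cA : closed A.
  by apply: compact_closed cptA; exact: norm_hausdorff.
rewrite -(setCK A); apply: measurableC; apply: open_measurable_mx.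
exact: closed_openC.
Qed.

Lemma measurable_cube n (M : R) : measurable (cube n M).
Proof. by apply: measurable_compact_mx; exact: compact_cube. Qed.

Lemma normr_coord_le m n (x : 'M[R]_(m, n)) i j : `|x i j| <= `|x|.
Proof.
rewrite [leRHS](_ : _ = mx_norm x)// mx_normrE.
exact: (le_bigmax _ (fun ij : 'I_m * 'I_n => `|x ij.1 ij.2|) (i, j)).
Qed.

Lemma bounded_sub_cube n (A : set 'rV[R]_n) : bounded_set A ->
  exists2 M, 0 < M & A `<=` cube n M.
Proof.
move=> [M [_ HM]]; exists (`|M| + 1); first by rewrite ltr_wpDl.
move=> x Ax i; rewrite (le_trans (normr_coord_le _ _ _))// HM//.
by rewrite (le_lt_trans (ler_norm _))// ltrDl.
Qed.

Lemma compact_sub_cube n (A : set 'rV[R]_n) : compact A ->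
  exists2 M, 0 < M & A `<=` cube n M.
Proof. by move=> /compact_bounded; exact: bounded_sub_cube. Qed.

Lemma bigcup_cube n : \bigcup_k cube n k%:R = setT.
Proof.
rewrite -subTset => x _; exists (Num.truncn `|x|).+1 => // i.
by rewrite (le_trans (normr_coord_le _ _ _))// ltW// truncnS_gt.
Qed.

(** Through [cons_row] the cube of dimension n + 1 is the product of [-M, M] and the cube of
    dimension n, so its measure is a product of finite factors; in dimension 0 the measure is a unit
    mass. *)
Lemma lebesgue_cube_lty n (M : R) : (lebesgue R n (cube n M) < +oo)%E.
Proof.
elim: n => [|n IHn].
  by rewrite (le_lt_trans (probability_le1 _ _)) ?ltry//; exact: measurable_cube.
have mI : measurable `[- M, M]%classic by [].
rewrite [ltLHS](_ : _ = (lebesgue_measure `[(- M)%R, M]%classic * lebesgue R n (cube n M))%E).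
  rewrite lte_mul_pinfty//.
    by rewrite ge0_fin_numE// lebesgue_measure_itv/=; case: ifP => _; rewrite ?ltry.
rewrite /= /lebesgueS /pushforward -product_measure1E//; last exact: measurable_cube.
congr (_ _); apply/seteqP; split => [[t x] /= tx|[t x] /= [tM xM] i].
  split => [|i].
    by have := tx ord0; rewrite cons_rowE unlift_none ler_norml in_itv.
  by have := tx (lift ord0 i); rewrite cons_rowE liftK.
rewrite cons_rowE; case: unliftP => [k _ /=|_ /=]; first exact: xM.
by move: tM; rewrite /= in_itv/= -ler_norml.
Qed.

Lemma lebesgue_compact_lty n (A : set 'rV[R]_n) : compact A -> (lebesgue R n A < +oo)%E.
Proof.
move=> cA; have [M _ AM] := compact_sub_cube cA.
rewrite (le_lt_trans _ (lebesgue_cube_lty n M))// le_measure// inE.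
  exact: measurable_compact_mx.
exact: measurable_cube.
Qed.

Lemma measurable_cons_row_lebesgue n :
  measurable_fun [set: measurableTypeR R * 'rV[R]_n] (@cons_row R n).
Proof. exact: measurable_cons_row. Qed.

Lemma integral_lebesgueS n (f : 'rV[R]_n.+1 -> \bar R) :
  measurable_fun setT f ->
  (lebesgue_measure \x lebesgue R n)%E.-integrable setT (f \o @cons_row R n) ->
  (\int[lebesgue R n.+1]_x f x =
   \int[lebesgue_measure \x lebesgue R n]_tx f (cons_row tx))%E.
Proof.
move=> mf intf.
exact: (integral_pushforward (@measurable_cons_row_lebesgue n) mf intf measurableT).
Qed.

Lemma integrable_cons_row n (f : 'rV[R]_n.+1 -> \bar R) :
  (lebesgue R n.+1).-integrable setT f ->
  (lebesgue_measure \x lebesgue R n)%E.-integrable setT (f \o @cons_row R n).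
Proof.
move=> /integrableP[mf fty]; apply/integrableP; split.
  exact: measurableT_comp mf (@measurable_cons_row_lebesgue _).
rewrite (le_lt_trans _ fty)//.
have := ge0_integral_pushforward (@measurable_cons_row_lebesgue n)
  (lebesgue_measure \x lebesgue R n)%E measurableT (measurableT_comp (@abse_measurable R _) mf).
by move=> /(_ (fun x _ => abse_ge0 _))<-.
Qed.

End lebesgue_rV.

Arguments cube {R} n M _.

(** * Integration of partial derivatives *)

Section integration_by_parts.
Context (R : realType).

Lemma continuous_cube_bounded n (f : 'rV[R]_n -> R) (M : R) : continuous f ->
  (forall x, ~ cube n M x -> f x = 0) -> exists2 C, 0 < C & forall x, `|f x| <= C.
Proof.
move=> cf f0; have : compact (f @` cube n M).
  apply: continuous_compact; last exact: compact_cube.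
  exact: continuous_subspaceT.
move=> /compact_bounded[C [_ HC]]; exists (`|C| + 1); first by rewrite ltr_wpDl.
move=> x; have [xM|/f0->] := pselect (cube n M x); last by rewrite normr0 addr_ge0.
apply: HC; last by exists x.
by rewrite (le_lt_trans (ler_norm _))// ltrDl.
Qed.

Lemma integrable_bounded_cube n (f : 'rV[R]_n -> R) (C M : R) :
  measurable_fun setT f -> (forall x, `|f x| <= C) ->
  (forall x, ~ cube n M x -> f x = 0) ->
  (lebesgue R n).-integrable setT (EFin \o f).
Proof.
move=> mf fC f0; have C0 : 0 <= C by apply: le_trans (fC 0).
apply: (@le_integrable _ _ _ _ _ measurableT _ (fun x => C%:E * (\1_(cube n M) x)%:E)%E).
- exact/measurable_EFinP.
- move=> x _; rewrite /= lee_fin indicE [leRHS]ger0_norm ?mulr_ge0//.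
  have [xM|xM] := pselect (cube n M x); first by rewrite mem_set// mulr1.
  by rewrite memNset// f0// normr0 mulr0.
apply: integrableZl => //; apply/integrableP; split.
  by apply/measurable_EFinP; apply: measurable_indic; exact: measurable_cube.
under eq_integral do rewrite gee0_abs ?lee_fin//.
rewrite integral_indic ?setIT//; last exact: measurable_cube.
exact: lebesgue_cube_lty.
Qed.

(** The fundamental theorem of calculus on an interval at whose ends f vanishes. *)
Lemma integral_derive1_eq0 (f : R -> R) (M : R) :
  (forall x, derivable f x 1) -> continuous (derive1 f) ->
  (forall x, M < `|x| -> f x = 0) ->
  (\int[lebesgue_measure]_x (derive1 f x)%:E = 0)%E.
Proof.
move=> df cf f0.
(* N is positive and exceeds M strictly, so that f vanishes at both ends of [-N, N] and its
   derivative vanishes outside. *)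
pose N := `|M| + 1; have MN : M < N by rewrite (le_lt_trans (ler_norm _))// ltrDl.
have N0 : 0 < N by rewrite ltr_wpDl.
have f'0 x : M < `|x| -> derive1 f x = 0.
  move=> xM; rewrite derive1E (@near_eq_derive _ _ _ _ (cst 0)) ?derive_cst//.
  near=> y; apply: f0; near: y.
  have xx : y @[y --> x] --> x by exact: cvg_id.
  exact: cvgr_gt (cvg_norm xx) _ xM.
transitivity (\int[lebesgue_measure]_(x in `[(- N)%R, N]) (derive1 f x)%:E)%E.
  rewrite [RHS]integral_mkcond; apply: eq_integral => x _; rewrite patchE.
  case: ifPn => // /negP xN; rewrite f'0// (lt_le_trans MN)//.
  rewrite leNgt; apply/negP => xN'; apply: xN; rewrite inE/= in_itv/=.
  by rewrite -ler_norml ltW.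
have cderiv x : {for x, continuous f}.
  by apply: differentiable_continuous; apply/derivable1_diffP.
transitivity ((f N)%:E - (f (- N))%:E)%E; last first.
  have fN : f N = 0 by apply: f0; rewrite gtr0_norm.
  have fNN : f (- N) = 0 by apply: f0; rewrite normrN gtr0_norm.
  by rewrite fN fNN -EFinB subrr.
have NN : - N < N by rewrite (lt_trans _ N0)// oppr_lt0.
have cfN : {within `[- N, N], continuous (derive1 f)} by exact: continuous_subspaceT.
have dfN : derivable_oo_LRcontinuous f (- N) N.
  split; [by move=> x _; exact: df| |].
  + by apply: cvg_at_right_filter; exact: cderiv.
  + by apply: cvg_at_left_filter; exact: cderiv.
have eN : {in `]- N, N[, derive1 f =1 derive1 f} by [].
exact: (@continuous_FTC2 R (derive1 f) f (- N) N NN cfN dfN eN).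
Unshelve. all: by end_near. Qed.

(** The two difference quotients are the same function of h. This transfers directional derivatives
    to slices and to functions of one real variable. *)
Lemma derive_reparam (V W : normedModType R) (f : V -> R) (g : W -> R) x y v w :
  (forall h, f (h *: v + x) = g (h *: w + y)) ->
  (derivable f x v -> derivable g y w) /\ 'D_v f x = 'D_w g y.
Proof.
move=> fg; have fgE : (fun h => h^-1 *: ((f \o shift x) (h *: v) - f x)) =
    (fun h => h^-1 *: ((g \o shift y) (h *: w) - g y)).
  apply/funext => h; rewrite /= fg.
  by have := fg 0; rewrite !scale0r !add0r => ->.
by rewrite /derivable /derive fgE.
Qed.

(** The complement of the cube is open, so f vanishes in a neighbourhood of x. *)
Lemma partial_eq0 n (i : 'I_n) (f : 'rV[R]_n -> R) (M : R) :
  (forall x, ~ cube n M x -> f x = 0) ->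
  forall x, ~ cube n M x -> partial i f x = 0.
Proof.
move=> f0 x xM; rewrite /partial (@near_eq_derive _ _ _ _ (cst 0)) ?derive_cst//.
near=> y; apply: f0; near: y.
apply: open_nbhs_nbhs; split => //; apply: closed_openC.
by apply: compact_closed; [exact: norm_hausdorff|exact: compact_cube].
Unshelve. all: by end_near. Qed.

Lemma cons_row_shift0 n (h t : R) (x : 'rV[R]_n) :
  h *: delta_mx ord0 ord0 + cons_row (t, x) = cons_row (h + t, x).
Proof.
apply/rowP => j; rewrite mxE !cons_rowE !mxE/=; case: unliftP => [k ->|->] /=.
  by rewrite mulr0 add0r.
by rewrite mulr1.
Qed.

Lemma cons_row_shiftS n (k : 'I_n) (h t : R) (x : 'rV[R]_n) :
  h *: delta_mx ord0 (lift ord0 k) + cons_row (t, x) =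
  cons_row (t, h *: delta_mx ord0 k + x).
Proof.
apply/rowP => j; rewrite mxE !cons_rowE !mxE/=; case: unliftP => [l ->|->] /=.
  by rewrite !mxE/= (inj_eq lift_inj).
by rewrite mulr0 add0r.
Qed.

Lemma cons_row_dist n (s t : R) (x y : 'rV[R]_n) :
  `|cons_row (s, x) - cons_row (t, y)| <= Num.max `|s - t| `|x - y|.
Proof.
rewrite [leLHS](_ : _ = mx_norm (cons_row (s, x) - cons_row (t, y)))// mx_normrE.
apply: bigmax_le => [|[i j] _ /=]; first by rewrite le_max normr_ge0.
rewrite mxE [X in _ + X]mxE !cons_rowE le_max; case: unliftP => [k _ /=|_ /=].
  by apply/orP; right; have := normr_coord_le (x - y) ord0 k; rewrite mxE [X in _ + X]mxE.
by rewrite lexx.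
Qed.

Lemma continuous_cons_row2 n (t : R) : continuous (fun x : 'rV[R]_n => cons_row (t, x)).
Proof.
move=> x; apply/(cvgrPdist_lt (F := nbhs x)) => e e0.
have := nbhsx_ballx x _ e0; rewrite -ball_normE; apply: (@filterS _ (nbhs x)) => y xy.
by rewrite (le_lt_trans (cons_row_dist _ _ _ _))// gt_max subrr normr0 e0.
Qed.

Lemma continuous_cons_row1 n (x : 'rV[R]_n) : continuous (fun t : R => cons_row (t, x)).
Proof.
move=> t; apply/cvgrPdist_lt => e e0.
have := nbhsx_ballx t _ e0; rewrite -ball_normE; apply: filterS => s ts.
by rewrite (le_lt_trans (cons_row_dist _ _ _ _))// gt_max subrr normr0 e0 andbT.
Qed.

(** Induction on the dimension and Fubini: the integration that is carried out first is the one over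
    variables containing the direction of differentiation, and it already gives 0. *)
Lemma integral_partial_eq0 n (i : 'I_n) (f : 'rV[R]_n -> R) (M : R) :
  (forall x, derivable f x (delta_mx ord0 i)) -> continuous (partial i f) ->
  (forall x, ~ cube n M x -> f x = 0) ->
  (\int[lebesgue R n]_x (partial i f x)%:E = 0)%E.
Proof.
elim: n i f => [[]//|n IHn] i f df cf f0.
have mf := measurable_continuous_mx cf.
have [C _ fC] := continuous_cube_bounded cf (partial_eq0 i f0).
have /integrable_cons_row intf := integrable_bounded_cube mf fC (partial_eq0 i f0).
rewrite integral_lebesgueS//; last exact/measurable_EFinP.
case: (unliftP ord0 i) df cf mf fC intf => [k ->|->] df cf mf fC intf.
(* The direction lies in the last n coordinates: with the first coordinate t fixed, the induction
   hypothesis applies to the slice. *)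
- rewrite -(integral12_prod_meas1 intf); apply: integral0_eq => t _.
  rewrite /fubini_F; pose g x := f (cons_row (t, x)).
  have gf x := derive_reparam
    (fun h => congr1 f (cons_row_shiftS k h t x) : _ = g (h *: delta_mx ord0 k + x)).
  have gE : partial k g = partial (lift ord0 k) f \o (fun x => cons_row (t, x)).
    by apply/funext => x; rewrite /partial/= (gf x).2.
  rewrite (eq_integral (fun x => (partial k g x)%:E)); last by move=> x _; rewrite gE.
  apply: IHn => [x||x xM].
  + exact: (gf x).1.
  + by rewrite gE => x; apply: continuous_comp; [exact: continuous_cons_row2|exact: cf].
  + apply: f0 => /= H; apply: xM => j.
    by have := H (lift ord0 j); rewrite cons_rowE liftK.
(* The direction is the first coordinate: with the others fixed, the slice is a function of one real
   variable. *)
- rewrite -(integral21_prod_meas1 intf); apply: integral0_eq => x _.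
  rewrite /fubini_G; pose g t := f (cons_row (t, x)).
  have gf t : (derivable f (cons_row (t, x)) (delta_mx ord0 ord0) -> derivable g t 1) /\
      partial ord0 f (cons_row (t, x)) = 'D_1 g t.
    by apply: derive_reparam => h; rewrite cons_row_shift0/= scaler1.
  have gE : derive1 g = partial ord0 f \o (fun t => cons_row (t, x)).
    by apply/funext => t; rewrite derive1E /= (gf t).2.
  transitivity (\int[lebesgue_measure]_t (derive1 g t)%:E)%E.
    by apply: eq_integral => t _; rewrite gE.
  apply: (@integral_derive1_eq0 _ M) => [t||t tM].
  + exact: (gf t).1.
  + by rewrite gE => t; apply: continuous_comp; [exact: continuous_cons_row1|exact: cf].
  + apply: f0 => /(_ ord0); rewrite cons_rowE unlift_none/=.
    by rewrite leNgt tM.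
Qed.

End integration_by_parts.

(** * Smooth functions and smooth ramps *)

Section smooth.
Context (R : realType) (n : nat).
Local Notation V := 'rV[R]_n.
Implicit Types f g : V -> R.

Lemma Ck_continuous k f : Ck k f -> continuous f.
Proof. by case: k => [|k] []. Qed.

Lemma CkS k f : Ck k.+1 f -> Ck k f.
Proof.
elim: k f => [|k IHk] f [cf df]; split=> // i.
by have [dfi /IHk] := df i.
Qed.

Lemma Ck_derivable k f i x : Ck k.+1 f -> derivable f x (delta_mx ord0 i).
Proof. by case=> _ /(_ i)[]. Qed.

Lemma Ck_partial k f i : Ck k.+1 f -> Ck k (partial i f).
Proof. by case=> _ /(_ i)[]. Qed.

Lemma Ck_cst k (c : R) : Ck k (fun _ : V => c).
Proof.
elim: k c => [|k IHk] c; split=> //; try exact: cst_continuous.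
move=> i; split=> [x|]; first exact: derivable_cst.
rewrite (_ : partial i _ = cst 0); first exact: IHk.
by apply/funext => x; rewrite /partial derive_cst.
Qed.

Lemma CkD k f g : Ck k f -> Ck k g -> Ck k (f \+ g).
Proof.
elim: k f g => [|k IHk] f g kf kg; (split=> [x|]; first by
  apply: continuousD; [exact: (Ck_continuous kf)|exact: (Ck_continuous kg)]) => //.
move=> i; split=> [x|]; first by have := derivableD (Ck_derivable kf) (Ck_derivable kg).
rewrite (_ : partial i _ = partial i f \+ partial i g).
  by apply: IHk; [exact: (Ck_partial i kf)|exact: (Ck_partial i kg)].
by apply/funext => x; exact: deriveD (Ck_derivable kf) (Ck_derivable kg).
Qed.

Lemma partialM f g i x : derivable f x (delta_mx ord0 i) ->
  derivable g x (delta_mx ord0 i) ->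
  partial i (f \* g) x = f x * partial i g x + g x * partial i f x.
Proof. exact: deriveM. Qed.

Lemma CkM k f g : Ck k f -> Ck k g -> Ck k (f \* g).
Proof.
elim: k f g => [|k IHk] f g kf kg; (split=> [x|]; first by
  apply: continuousM; [exact: (Ck_continuous kf)|exact: (Ck_continuous kg)]) => //.
move=> i; split=> [x|]; first by have := derivableM (Ck_derivable kf) (Ck_derivable kg).
rewrite (_ : partial i _ = (f \* partial i g) \+ (g \* partial i f)).
  by apply: CkD; apply: IHk; do [exact: CkS|exact: Ck_partial].
by apply/funext => x; exact: partialM (Ck_derivable kf) (Ck_derivable kg).
Qed.

(** On the line through x with direction v, f becomes a function g of one real variable, and the
    chain rule is applied to H and g at 0. *)
Lemma is_derive_comp1 (H : R -> R) f x v (dH : R) :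
  derivable f x v -> is_derive (f x) 1 H dH ->
  is_derive x v (H \o f) (dH * 'D_v f x).
Proof.
move=> df HH; pose g (h : R) := f (h *: v + x).
have fg h : f (h *: v + x) = g (h *: 1 + 0).
  by rewrite /g [h *: 1]mulr1 addr0.
have [/(_ df) dg Dg] := derive_reparam fg.
have Hg h : (H \o g) (h *: 1 + 0) = (H \o f) (h *: v + x) by rewrite /= fg.
have g0 : g 0 = f x by rewrite /g scale0r add0r.
have gD : is_derive (0 : R) 1 g ('D_v f x) by rewrite Dg; exact: derivableP.
rewrite -g0 in HH.
have HgD := is_derive1_comp HH gD.
have [/(_ (@ex_derive _ _ _ _ _ _ _ HgD)) dHf DHf] := derive_reparam Hg.
by apply: DeriveDef => //; rewrite -DHf (@derive_val _ _ _ _ _ _ _ HgD).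
Qed.

End smooth.

Section smooth_truncation.
Context (R : realType) (d : R).
Context (d0 : 0 < d).

(** A smooth substitute for the absolute value: it lies between |t| and |t| + d and never drops
    below d. *)
Definition hyp (t : R) : R := Num.sqrt (t ^+ 2 + d ^+ 2).

(* [ramp] and its derivative [ramp'] converge pointwise, as d tends to 0, to
   the positive part and to the indicator of the positive reals, with value
   1/2 at 0. *)
Definition ramp (t : R) : R := (hyp t + t - d) / 2.
Definition ramp' (t : R) : R := (t / hyp t + 1) / 2.

Lemma hyp_gt0 t : 0 < hyp t.
Proof. by rewrite sqrtr_gt0 ltr_wpDl ?sqr_ge0// exprn_gt0. Qed.

Lemma hyp_neq0 t : hyp t != 0.
Proof. by rewrite gt_eqF// hyp_gt0. Qed.

Lemma sqr_hyp t : hyp t ^+ 2 = t ^+ 2 + d ^+ 2.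
Proof. by rewrite sqr_sqrtr// addr_ge0 ?sqr_ge0. Qed.

Lemma is_derive_hyp (t : R) : is_derive t (1 : R) hyp (t / hyp t).
Proof.
have D1 : is_derive t (1 : R) (fun t : R => t ^+ 2 + d ^+ 2) (2 * t).
  have Did := is_derive_id t (1 : R).
  have DX := is_deriveX 2 Did.
  apply: is_derive_eq (is_deriveD DX (is_derive_cst (d ^+ 2 : R) t (1 : R))) _.
  by rewrite addr0 expr1 [_ *: _]mulr1.
have DS : is_derive (t ^+ 2 + d ^+ 2) (1 : R) Num.sqrt (2 * hyp t)^-1.
  by apply: is_derive1_sqrt; rewrite -sqrtr_gt0 hyp_gt0.
have DC := @is_derive1_comp R Num.sqrt (fun t : R => t ^+ 2 + d ^+ 2) t _ _ DS D1.
rewrite (_ : t / hyp t = (2 * hyp t)^-1 * (2 * t)); first exact: DC.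
by field; rewrite hyp_neq0.
Qed.

Lemma is_derive_inv_hyp (t : R) :
  is_derive t (1 : R) (fun t => (hyp t)^-1) (- (t * (hyp t)^-1 * (hyp t)^-1 * (hyp t)^-1)).
Proof.
apply: is_derive_eq (is_deriveV (hyp_neq0 t) (is_derive_hyp t)) _.
rewrite [_ *: _]mulrA; field.
by rewrite hyp_neq0.
Qed.

Lemma is_derive_ramp (t : R) : is_derive t (1 : R) ramp (ramp' t).
Proof.
have Did := is_derive_id t (1 : R).
have D := is_deriveZ (2^-1) (is_deriveB (is_deriveD (is_derive_hyp t) Did)
  (is_derive_cst (d : R) t (1 : R))).
rewrite (_ : ramp = 2^-1 \*: (hyp + id - cst d)).
  rewrite (_ : ramp' t = 2^-1 *: (t / hyp t + 1 - 0)); first exact: D.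
  by rewrite subr0 /ramp' mulrC.
by apply/funext => s; rewrite /ramp mulrC.
Qed.

Lemma ramp0 : ramp 0 = 0.
Proof. by rewrite /ramp /hyp expr0n/= add0r sqrtr_sqr gtr0_norm// addr0 subrr mul0r. Qed.

Context (n : nat).
Implicit Types f : 'rV[R]_n -> R.

Lemma partial_comp1 (H : R -> R) f i x (dH : R) :
  derivable f x (delta_mx ord0 i) -> is_derive (f x) (1 : R) H dH ->
  partial i (H \o f) x = dH * partial i f x.
Proof.
by move=> df HH; have D := is_derive_comp1 df HH; rewrite /partial derive_val.
Qed.

(** With r = 1 / hyp(f), the chain rule gives partial_i r = - f r^3 partial_i f. The right-hand side
    is of class C^k as soon as r is, which drives the induction. *)
Lemma smooth_inv_hyp f : (forall k, Ck k f) -> forall k, Ck k (fun x => (hyp (f x))^-1).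
Proof.
pose r x := (hyp (f x))^-1.
move=> sf; have cr : continuous r.
  move=> x; apply: (@continuous_comp _ _ _ f (fun t => (hyp t)^-1)).
    exact: (Ck_continuous (sf 0%N)).
  apply: differentiable_continuous; apply/derivable1_diffP.
  exact: (@ex_derive _ _ _ _ _ _ _ (is_derive_inv_hyp (f x))).
elim=> [|k IHk]; split=> // i.
have D x := is_derive_comp1 (Ck_derivable (sf 1%N) (i := i) (x := x)) (is_derive_inv_hyp (f x)).
split=> [x|]; first exact: (@ex_derive _ _ _ _ _ _ _ (D x)).
rewrite (_ : partial i _ = (fun _ => -1) \* (f \* r \* r \* r \* partial i f)).
  apply: CkM; first exact: Ck_cst.
  apply: CkM; last exact: (Ck_partial i (sf k.+1)).
  by do 3![apply: CkM => //].
apply/funext => x.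
rewrite (partial_comp1 (Ck_derivable (sf 1%N) (i := i) (x := x)) (is_derive_inv_hyp (f x))).
by rewrite /= mulN1r mulNr.
Qed.

(** Since hyp = (t^2 + d^2) / hyp, smoothness of the reciprocal of [hyp] and algebra suffice. *)
Lemma smooth_ramp f : (forall k, Ck k f) -> forall k, Ck k (ramp \o f).
Proof.
move=> sf k; rewrite (_ : ramp \o f =
  ((((f \* f) \+ (fun _ => d ^+ 2)) \* (fun x => (hyp (f x))^-1)) \+ f \+ (fun _ => - d))
    \* (fun _ => 2^-1)).
  apply: CkM; last exact: Ck_cst.
  apply: CkD; last exact: Ck_cst.
  apply: CkD => //; apply: CkM; last exact: smooth_inv_hyp.
  by apply: CkD; [exact: CkM|exact: Ck_cst].
apply/funext => x; rewrite /= /ramp -expr2 -sqr_hyp expr2 -mulrA divff ?mulr1//.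
exact: hyp_neq0.
Qed.

(** Because [ramp] vanishes at 0, composing with it does not enlarge the support. *)
Lemma Cc_infty_ramp f : Cc_infty f -> Cc_infty (ramp \o f).
Proof.
move=> [sf cf]; split; first exact: smooth_ramp.
apply: subclosed_compact cf _; first exact: closed_closure.
apply: closure_subset => x /=; apply: contra_neq => ->; exact: ramp0.
Qed.

End smooth_truncation.

(** * L^p estimates *)

Section Lpow.
Context d (T : measurableType d) (R : realType) (mu : {measure set T -> \bar R}).
Implicit Types (f g : T -> R) (p : R).

(* The integral of a nonnegative function is a supremum over the simple
   functions below it, so that monotonicity does not need measurability. *)
Lemma ge0_le_integral_sup (D : set T) (f g : T -> \bar R) :
  (forall x, D x -> 0 <= f x)%E -> (forall x, D x -> f x <= g x)%E ->
  (\int[mu]_(x in D) f x <= \int[mu]_(x in D) g x)%E.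
Proof.
move=> f0 fg; rewrite !ge0_integralE//; last first.
  by move=> x Dx; rewrite (le_trans (f0 _ Dx))// fg.
apply: ge_ereal_sup => _ [h hf <-]; apply: ereal_sup_ubound; exists h => //= x.
rewrite (le_trans (hf x))// !patchE; case: ifPn => //; rewrite inE; exact: fg.
Qed.

(** The p-th power of the L^p norm. Estimates are made without roots, at the price of a factor 2^p
    in the triangle inequality. *)
Definition Lpow p f : \bar R := (\int[mu]_x (`|f x| `^ p)%:E)%E.

Lemma Lpow_ge0 p f : (0 <= Lpow p f)%E.
Proof. by apply: integral_ge0 => x _; rewrite lee_fin powR_ge0. Qed.

Lemma measurable_Lpow p f : measurable_fun setT f ->
  measurable_fun setT (fun x => (`|f x| `^ p)%:E).
Proof.
move=> mf; apply/measurable_EFinP.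
apply: (measurableT_comp (measurable_powR p)).
exact: measurableT_comp.
Qed.

Lemma le_Lpow p f g : 0 <= p -> (forall x, `|f x| <= `|g x|) -> (Lpow p f <= Lpow p g)%E.
Proof.
move=> p0 fg; apply: ge0_le_integral_sup => x _; first by rewrite lee_fin powR_ge0.
by rewrite lee_fin ge0_ler_powR// nnegrE.
Qed.

Lemma powR_normD p (a b : R) : 0 <= p ->
  `|a + b| `^ p <= 2 `^ p * (`|a| `^ p + `|b| `^ p).
Proof.
(* By symmetry b has the larger absolute value, so |a + b| <= 2 |b|. *)
move=> p0; wlog ab : a b / `|a| <= `|b|.
  move=> H; have [/H//|/ltW/H ?] := leP `|a| `|b|.
  by rewrite addrC [in leRHS]addrC.
have : `|a + b| `^ p <= (2 * `|b|) `^ p.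
  rewrite ge0_ler_powR// ?nnegrE ?mulr_ge0//.
  by rewrite (le_trans (ler_normD _ _))// mulr_natl mulr2n lerD2r.
move=> /le_trans; apply; rewrite powRM// ler_wpM2l ?powR_ge0//.
by rewrite lerDr powR_ge0.
Qed.

Lemma LpowD p f g : 0 <= p -> measurable_fun setT f -> measurable_fun setT g ->
  (Lpow p (f \+ g)%R <= (2 `^ p)%:E * (Lpow p f + Lpow p g))%E.
Proof.
move=> p0 mf mg.
have ge0 (h : T -> R) x : [set: T] x -> (0 <= (`|h x| `^ p)%:E)%E by rewrite lee_fin powR_ge0.
rewrite -(ge0_integralD mu measurableT (ge0 f) (measurable_Lpow p mf) (ge0 g)
  (measurable_Lpow p mg)).
have ge0D x : [set: T] x -> (0 <= (`|f x| `^ p)%:E + (`|g x| `^ p)%:E)%E.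
  by move=> _; rewrite -EFinD lee_fin addr_ge0 ?powR_ge0.
have mD := emeasurable_funD (measurable_Lpow p mf) (measurable_Lpow p mg).
rewrite -(ge0_integralZl_EFin mu measurableT ge0D mD (powR_ge0 2 p)).
apply: ge0_le_integral_sup => x _; first by rewrite lee_fin powR_ge0.
by rewrite -EFinD -EFinM lee_fin powR_normD.
Qed.

Lemma LpowZ p (c : R) f : 0 <= p -> measurable_fun setT f ->
  Lpow p (fun x => c * f x) = ((`|c| `^ p)%:E * Lpow p f)%E.
Proof.
move=> p0 mf.
have ge0 x : [set: T] x -> (0 <= (`|f x| `^ p)%:E)%E by rewrite lee_fin powR_ge0.
rewrite -(ge0_integralZl_EFin mu measurableT ge0 (measurable_Lpow p mf) (powR_ge0 _ p)).
by apply: eq_integral => x _; rewrite normrM powRM// EFinM.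
Qed.

Lemma powR_continuous0 p (u : nat -> R) : 0 < p -> (forall k, 0 <= u k) ->
  u k @[k --> \oo] --> 0 -> u k `^ p @[k --> \oo] --> 0.
Proof.
move=> p0 u0 ucvg; apply/cvgrPdist_lt => e e0.
have ep0 : 0 < e `^ p^-1 by rewrite powR_gt0.
move/cvgrPdist_lt : ucvg => /(_ _ ep0); apply: filterS => k.
rewrite !sub0r !normrN !ger0_norm ?powR_ge0// => uk.
rewrite (lt_le_trans (gt0_ltr_powR p0 _ _ uk)) ?nnegrE ?powR_ge0//.
by rewrite -powRrM mulVf ?gt_eqF// powRr1// ltW.
Qed.

(** Dominated convergence for |h_k|^p, with limit 0 and integrable majorant |g|^p. *)
Lemma Lpow_dominated p (h : nat -> T -> R) g : 0 < p ->
  (forall k, measurable_fun setT (h k)) -> measurable_fun setT g ->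
  (forall x, h k x @[k --> \oo] --> 0) -> (forall k x, `|h k x| <= `|g x|) ->
  (Lpow p g < +oo)%E ->
  forall e, 0 < e -> \forall k \near \oo, (Lpow p (h k) < e%:E)%E.
Proof.
move=> p0 mh mg h0 hg goo e e0.
have [] := @dominated_convergence _ T R mu setT measurableT
  (fun k x => (`|h k x| `^ p)%:E) (cst 0%E) (fun x => (`|g x| `^ p)%:E).
- by move=> k; exact: measurable_Lpow.
- exact: measurable_cst.
- apply: aeW => x _; apply: cvg_EFin; first by near=> k.
  apply: powR_continuous0 => //.
  rewrite -(@normr0 _ R); apply: cvg_norm; exact: h0.
- apply/integrableP; split; first exact: measurable_Lpow.
  by under eq_integral do rewrite gee0_abs ?lee_fin ?powR_ge0//.
- apply: aeW => x k _; rewrite gee0_abs ?lee_fin ?powR_ge0//.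
  by rewrite ge0_ler_powR ?nnegrE// ltW.
move=> _ _; rewrite integral_cst// mul0e => lim0.
have e_nbhs : nbhs (0%E : \bar R) [set y | (y < e%:E)%E].
  apply: open_nbhs_nbhs; split; first exact: open_ereal_lt_ereal.
  by rewrite /= lte_fin.
exact: lim0 _ e_nbhs.
Unshelve. all: by end_near. Qed.

(** Either t <= eta, or t^(p-1) >= eta^(p-1) and then t = t^p / t^(p-1) is at most the second
    term. *)
Lemma ler_split_powR p (eta t : R) : 1 <= p -> 0 < eta -> 0 <= t ->
  t <= eta + (eta `^ (p - 1))^-1 * t `^ p.
Proof.
move=> p1 eta0 t0; have p0 : 0 < p by rewrite (lt_le_trans _ p1).
have [te|/ltW et] := leP t eta.
  by rewrite (le_trans te)// lerDl mulr_ge0 ?powR_ge0// invr_ge0 powR_ge0.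
rewrite (@le_trans _ _ ((eta `^ (p - 1))^-1 * t `^ p))//; last first.
  by rewrite lerDr ltW.
rewrite -[t `^ p]mulr_powRB1// mulrCA ler_peMr// mulrC ler_pdivlMr ?powR_gt0// mul1r.
by rewrite ge0_ler_powR ?nnegrE ?subr_ge0// ltW.
Qed.

(** This plays the part of Hoelder's inequality on sets of finite measure: eta makes the first term
    small, and then a small [Lpow] makes the second term small. *)
Lemma le_integral_norm_Lpow p (A : set T) (eta : R) f :
  1 <= p -> 0 < eta -> measurable A -> measurable_fun setT f ->
  (\int[mu]_(x in A) `|f x|%:E <=
   eta%:E * mu A + ((eta `^ (p - 1))^-1)%:E * Lpow p f)%E.
Proof.
move=> p1 eta0 mA mf; have p0 : 0 <= p by rewrite (le_trans _ p1).
have c0 : 0 <= (eta `^ (p - 1))^-1 by rewrite invr_ge0 powR_ge0.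
have mfp : measurable_fun A (fun x => (`|f x| `^ p)%:E).
  by apply: measurable_funTS; exact: measurable_Lpow.
rewrite (@le_trans _ _ (\int[mu]_(x in A)
    (eta%:E + ((eta `^ (p - 1))^-1)%:E * (`|f x| `^ p)%:E)))%E//.
  apply: ge0_le_integral_sup => x _; rewrite ?lee_fin//.
  exact: ler_split_powR.
rewrite ge0_integralD//; [|by move=> x _; rewrite lee_fin ltW|
  by move=> x _; rewrite -EFinM lee_fin mulr_ge0 ?powR_ge0|exact: measurable_funeM].
rewrite integral_cst// leeD2l// ge0_integralZl_EFin//.
rewrite lee_wpmul2l ?lee_fin//; apply: ge0_subset_integral => //.
exact: measurable_Lpow.
Qed.

End Lpow.

(** * Weak differentiability by approximation *)

Section weak_gradient_closure.
Context (R : realType) (n : nat) (p : R).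
Context (p1 : 1 <= p).
Local Notation V := 'rV[R]_n.
Local Notation lambda := (lebesgue R n).
Implicit Types (F H phi psi : V -> R) (G : V -> V).

Let p0 : 0 < p. Proof. exact: lt_le_trans p1. Qed.

Lemma Cc_infty_cube psi : Cc_infty psi ->
  exists M : R, forall x, ~ cube n M x -> psi x = 0.
Proof.
move=> [_ /compact_sub_cube[M _ psiM]]; exists M => x xM.
apply/eqP/negPn/negP => psix; apply: xM; apply: psiM.
exact: subset_closure.
Qed.

Lemma Cc_infty_continuous psi : Cc_infty psi -> continuous psi.
Proof. by move=> [/(_ 0%N)/Ck_continuous]. Qed.

Lemma Cc_infty_continuous_partial psi i : Cc_infty psi -> continuous (partial i psi).
Proof. by move=> [/(_ 1%N)/(Ck_partial i)/Ck_continuous]. Qed.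

Lemma Lpow_cube_lty phi (M : R) : continuous phi ->
  (forall x, ~ cube n M x -> phi x = 0) -> (Lpow lambda p phi < +oo)%E.
Proof.
move=> cphi phi0; have [C C0 phiC] := continuous_cube_bounded cphi phi0.
apply: integrable_lty => //.
apply: (@integrable_bounded_cube _ _ (fun x => `|phi x| `^ p) (C `^ p) M).
- by apply/measurable_EFinP; apply: measurable_Lpow; exact: measurable_continuous_mx.
- by move=> x; rewrite ger0_norm ?powR_ge0// ge0_ler_powR ?nnegrE// ltW.
- by move=> x /phi0->; rewrite normr0 powR0// gt_eqF.
Qed.

Lemma Lpow_locally_integrable F : measurable_fun setT F ->
  (Lpow lambda p F < +oo)%E -> locally_integrable_rV F.
Proof.
move=> mF Foo A cA; have mA := measurable_compact_mx cA.
apply/integrableP; split; first by apply/measurable_EFinP; exact: measurable_funTS.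
apply: le_lt_trans (le_integral_norm_Lpow lambda p1 ltr01 mA mF) _.
by rewrite lte_add_pinfty// lte_mul_pinfty// ?lee_fin ?invr_ge0 ?powR_ge0//
  lebesgue_compact_lty.
Qed.

(** Local integrability gives measurability on each cube, and countably many cubes exhaust the
    space. *)
Lemma locally_integrable_measurable F : locally_integrable_rV F ->
  measurable_fun setT F.
Proof.
move=> lF; rewrite -(bigcup_cube R n); apply/measurable_fun_bigcup => k.
  exact: measurable_cube.
have /integrableP[/measurable_EFinP] := lF _ (@compact_cube R n k%:R).
by [].
Qed.

(** Membership in W_0^{1,p}, expressed coordinatewise through [Lpow]. It concerns a bare pair of
    functions, so it can be established before G is known to be a weak gradient of F. *)
Definition approx F G : Prop := forall e : R, 0 < e -> exists2 psi, Cc_infty psi &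
  (Lpow lambda p (F \- psi)%R < e%:E)%E /\
  forall i, (Lpow lambda p (fun x => G x ord0 i - partial i psi x)%R < e%:E)%E.

Lemma Lpow_lty_sub F phi : measurable_fun setT F -> measurable_fun setT phi ->
  (Lpow lambda p (F \- phi)%R < +oo)%E -> (Lpow lambda p phi < +oo)%E ->
  (Lpow lambda p F < +oo)%E.
Proof.
move=> mF mphi Fphi phioo.
have mB : measurable_fun setT (F \- phi) by exact: measurable_funB.
have := LpowD lambda (ltW p0) mB mphi.
rewrite (_ : (F \- phi) \+ phi = F); last by apply/funext => x /=; rewrite subrK.
move=> /le_lt_trans; apply.
by rewrite lte_mul_pinfty// ?lee_fin ?powR_ge0// lte_add_pinfty.
Qed.

Lemma approx_Lpow_lty F G : measurable_fun setT F -> approx F G ->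
  (Lpow lambda p F < +oo)%E.
Proof.
move=> mF /(_ 1 ltr01)[psi Cpsi [Fpsi _]].
have [M psi0] := Cc_infty_cube Cpsi; have cpsi := Cc_infty_continuous Cpsi.
apply: (@Lpow_lty_sub _ psi) => //; first exact: measurable_continuous_mx.
  by rewrite (lt_trans Fpsi) ?ltry.
exact: Lpow_cube_lty psi0.
Qed.

Lemma approx_grad_Lpow_lty F G i : measurable_fun setT (fun x => G x ord0 i) ->
  approx F G -> (Lpow lambda p (fun x => G x ord0 i) < +oo)%E.
Proof.
move=> mG /(_ 1 ltr01)[psi Cpsi [_ /(_ i) Gpsi]].
have [M psi0] := Cc_infty_cube Cpsi; have cpsi : continuous (partial i psi) := Cc_infty_continuous_partial Cpsi.
apply: (@Lpow_lty_sub _ (partial i psi)) => //; first exact: measurable_continuous_mx.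
  by rewrite (lt_trans Gpsi) ?ltry.
by apply: Lpow_cube_lty; last exact: partial_eq0 psi0.
Qed.

Lemma le_integral_normM F phi (C M : R) : 0 <= C -> measurable_fun setT F ->
  (forall x, `|phi x| <= C) -> (forall x, ~ cube n M x -> phi x = 0) ->
  (\int[lambda]_x `|F x * phi x|%:E <= C%:E * \int[lambda]_(x in cube n M) `|F x|%:E)%E.
Proof.
move=> C0 mF phiC phi0; have mM := @measurable_cube R n M.
rewrite -ge0_integralZl_EFin//; last first.
  by apply/measurable_EFinP; apply: measurableT_comp => //; exact: measurable_funTS.
rewrite [leRHS]integral_mkcond; apply: ge0_le_integral_sup => x _; first by rewrite lee_fin.
rewrite patchE; case: ifPn => [_|/negP xM].
  by rewrite -EFinM lee_fin normrM mulrC ler_wpM2r.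
by rewrite phi0 ?mulr0 ?normr0// => xM'; apply: xM; rewrite inE.
Qed.

Lemma locally_integrable_mul F phi (C M : R) : locally_integrable_rV F ->
  measurable_fun setT phi ->
  (forall x, `|phi x| <= C) -> (forall x, ~ cube n M x -> phi x = 0) ->
  lambda.-integrable setT (fun x => (F x * phi x)%:E).
Proof.
move=> lF mphi phiC phi0; have mF := locally_integrable_measurable lF.
have C0 : 0 <= C by apply: le_trans (phiC 0).
apply/integrableP; split; first by apply/measurable_EFinP; exact: measurable_funM.
apply: le_lt_trans (le_integral_normM C0 mF phiC phi0) _.
rewrite lte_mul_pinfty ?lee_fin//.
by have /integrableP[] := lF _ (@compact_cube R n M).
Qed.

(** Pairing with a bounded function supported in a cube is controlled by the integral of |H| over
    that cube, hence by [Lpow] of H. *)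
Lemma le_normr_Rintegral_Lpow H phi (C M eta e : R) : locally_integrable_rV H ->
  measurable_fun setT phi ->
  (forall x, `|phi x| <= C) -> (forall x, ~ cube n M x -> phi x = 0) ->
  0 < eta -> (Lpow lambda p H < e%:E)%E ->
  `|\int[lambda]_x (H x * phi x)| <=
    C * (eta * fine (lambda (cube n M)) + (eta `^ (p - 1))^-1 * e).
Proof.
move=> lH mphi phiC phi0 eta0 He; have mH := locally_integrable_measurable lH.
have C0 : 0 <= C by apply: le_trans (phiC 0).
have iH := locally_integrable_mul lH mphi phiC phi0.
have mM := @measurable_cube R n M.
rewrite -lee_fin EFin_normr_Rintegral//.
apply: le_trans (le_abse_integral _ _ _) _ => //; first by case/integrableP : iH.
apply: le_trans (le_integral_normM C0 mH phiC phi0) _.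
rewrite EFinM lee_wpmul2l ?lee_fin//.
apply: le_trans (le_integral_norm_Lpow lambda p1 eta0 mM mH) _.
rewrite EFinD [X in (_ <= X + _)%E]EFinM fineK; last first.
  by rewrite ge0_fin_numE// lebesgue_cube_lty.
by rewrite leeD2l// EFinM lee_wpmul2l ?lee_fin ?invr_ge0 ?powR_ge0// ltW.
Qed.

(** By the product rule the sum is the integral of the partial derivative of psi phi, which vanishes
    outside a cube. *)
Lemma Rintegral_by_parts phi psi i : Cc_infty phi -> Cc_infty psi ->
  \int[lambda]_x (psi x * partial i phi x) + \int[lambda]_x (partial i psi x * phi x) = 0.
Proof.
move=> Cphi Cpsi; have [M phi0] := Cc_infty_cube Cphi.
have cphi := Cc_infty_continuous Cphi; have cpsi := Cc_infty_continuous Cpsi.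
have cdphi : continuous (partial i phi) := Cc_infty_continuous_partial Cphi.
have cdpsi : continuous (partial i psi) := Cc_infty_continuous_partial Cpsi.
have int f : continuous f -> (forall x, ~ cube n M x -> f x = 0) ->
    lambda.-integrable setT (EFin \o f).
  move=> cf f0; have [C _ fC] := continuous_cube_bounded cf f0.
  exact: integrable_bounded_cube (measurable_continuous_mx cf) fC f0.
have dphi0 := partial_eq0 i phi0.
rewrite -RintegralD//; last 2 first.
- apply: (int (fun x => psi x * partial i phi x)) => [x|x /dphi0->].
    by apply: continuousM; [exact: cpsi|exact: cdphi].
  by rewrite mulr0.
- apply: (int (fun x => partial i psi x * phi x)) => [x|x /phi0->].
    by apply: continuousM; [exact: cdpsi|exact: cphi].
  by rewrite mulr0.
have CM : Ck 2 (psi \* phi) by apply: CkM; [case: Cpsi|case: Cphi].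
have pM x : psi x * partial i phi x + partial i psi x * phi x = partial i (psi \* phi) x.
  rewrite partialM.
  - by rewrite [partial i psi x * _]mulrC.
  - by case: Cpsi => /(_ 1%N)/Ck_derivable.
  - by case: Cphi => /(_ 1%N)/Ck_derivable.
under eq_Rintegral do rewrite pM.
rewrite /Rintegral (@integral_partial_eq0 _ _ _ _ M)//.
- by move=> x; apply: Ck_derivable CM.
- exact: Ck_continuous (Ck_partial i CM).
- by move=> x /phi0 /= ->; rewrite mulr0.
Qed.

(** Integration by parts is exact for each approximant psi, and the errors F - psi and G - grad psi
    have arbitrarily small pairings with the derivative of phi and with phi. *)
Lemma approx_weak_gradient F G : measurable_fun setT F ->
  (forall i, measurable_fun setT (fun x => G x ord0 i)) ->
  approx F G -> weak_gradient F G.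
Proof.
move=> mF mG FG.
have lF := Lpow_locally_integrable mF (approx_Lpow_lty mF FG).
have lG i := Lpow_locally_integrable (mG i) (approx_grad_Lpow_lty (mG i) FG).
split=> // phi Cphi i; apply/eqP; rewrite -addr_eq0 -normr_le0.
have [M phi0] := Cc_infty_cube Cphi; have dphi0 := partial_eq0 i phi0.
have cphi := Cc_infty_continuous Cphi.
have cdphi : continuous (partial i phi) := Cc_infty_continuous_partial Cphi.
have [C1 C10 phiC1] := continuous_cube_bounded cphi phi0.
have [C2 C20 dphiC2] := continuous_cube_bounded cdphi dphi0.
have mphi := measurable_continuous_mx cphi.
have mdphi := measurable_continuous_mx cdphi.
set L := fine (lambda (cube n M)).
have L0 : 0 <= L by rewrite fine_ge0.
apply/ler_addgt0Pr => e e0; rewrite add0r.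
(* The total error will be (C1 + C2) (L + 1) eta, which is e. *)
pose eta := e / ((C1 + C2) * (L + 1)).
have CL0 : 0 < (C1 + C2) * (L + 1).
  by apply: mulr_gt0; [exact: addr_gt0|exact: ltr_wpDl].
have eta0 : 0 < eta by rewrite divr_gt0.
(* The factor eta^(p-1) in the precision cancels its inverse in [le_normr_Rintegral_Lpow], leaving
   eta L + eta for each pairing. *)
have [|psi Cpsi [Fpsi /(_ i) Gpsi]] := FG (eta * eta `^ (p - 1)).
  by rewrite mulr_gt0// powR_gt0.
have cpsi := Cc_infty_continuous Cpsi.
have cdpsi : continuous (partial i psi) := Cc_infty_continuous_partial Cpsi.
have [N psi0] := Cc_infty_cube Cpsi.
have lpsi := Lpow_locally_integrable (measurable_continuous_mx cpsi)
  (Lpow_cube_lty cpsi psi0).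
have ldpsi := Lpow_locally_integrable (measurable_continuous_mx cdpsi)
  (Lpow_cube_lty cdpsi (partial_eq0 i psi0)).
have lB (f g : V -> R) : locally_integrable_rV f -> locally_integrable_rV g ->
    locally_integrable_rV (f \- g).
  by move=> lf lg A cA; apply: integrableB (lf _ cA) (lg _ cA); exact: measurable_compact_mx.
have Fbyparts : \int[lambda]_x ((F \- psi) x * partial i phi x) =
    \int[lambda]_x (F x * partial i phi x) - \int[lambda]_x (psi x * partial i phi x).
  rewrite -RintegralB//; [by apply: eq_Rintegral => x _; rewrite /= mulrBl| |];
    exact: locally_integrable_mul mdphi dphiC2 dphi0.
have Gbyparts : \int[lambda]_x (((fun x => G x ord0 i) \- partial i psi) x * phi x) =
    \int[lambda]_x (G x ord0 i * phi x) - \int[lambda]_x (partial i psi x * phi x).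
  rewrite -RintegralB//; [by apply: eq_Rintegral => x _; rewrite /= mulrBl| |];
    exact: locally_integrable_mul mphi phiC1 phi0.
(* The vanishing sum for psi is subtracted, so that only the differences F - psi and G - grad psi
   remain. *)
rewrite -[X in `|X|]subr0 -(Rintegral_by_parts i Cphi Cpsi) opprD addrACA -Fbyparts -Gbyparts.
rewrite (le_trans (ler_normD _ _))//.
rewrite (@le_trans _ _ (C2 * (eta * L + eta) + C1 * (eta * L + eta)))//.
  rewrite lerD//.
    have := le_normr_Rintegral_Lpow (lB _ _ lF lpsi) mdphi dphiC2 dphi0 eta0 Fpsi.
    by rewrite mulrCA mulVf ?mulr1// gt_eqF// powR_gt0.
  have := le_normr_Rintegral_Lpow (lB _ _ (lG i) ldpsi) mphi phiC1 phi0 eta0 Gpsi.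
  by rewrite mulrCA mulVf ?mulr1// gt_eqF// powR_gt0.
rewrite [leLHS](_ : _ = eta * ((C1 + C2) * (L + 1))); last by ring.
by rewrite /eta divfK// gt_eqF.
Qed.

End weak_gradient_closure.

(** * Bounds, Lipschitz constants and convergence rates of the ramps *)

Section ramp_estimates.
Context (R : realType) (d : R) (d0 : 0 < d).

Lemma normr_le_hyp (t : R) : `|t| <= hyp d t.
Proof.
by rewrite -(sqrtr_sqr t) ler_wsqrtr// lerDl sqr_ge0.
Qed.

Lemma ler_hyp_d (t : R) : d <= hyp d t.
Proof.
by rewrite -[leLHS]gtr0_norm// -(sqrtr_sqr d) ler_wsqrtr// lerDr sqr_ge0.
Qed.

Lemma hyp_le_normrD (t : R) : hyp d t <= `|t| + d.
Proof.
have td0 : 0 <= `|t| + d by rewrite addr_ge0// ltW.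
rewrite -[leRHS]ger0_norm// -(sqrtr_sqr (`|t| + d)) ler_wsqrtr//.
by rewrite sqrrD real_normK ?num_real// lerD2r lerDl mulrn_wge0// mulr_ge0// ltW.
Qed.

(** After multiplication by hyp(a) + hyp(b) the left side becomes |a^2 - b^2| = |a - b| |a + b|, and
    |a + b| <= hyp(a) + hyp(b). *)
Lemma hyp_lip (a b : R) : `|hyp d a - hyp d b| <= `|a - b|.
Proof.
have s0 : 0 < hyp d a + hyp d b by rewrite addr_gt0 ?hyp_gt0.
rewrite -(ler_pM2r s0) -{1}(gtr0_norm s0) -normrM -subr_sqr !sqr_hyp.
rewrite opprD addrACA subrr addr0 subr_sqr normrM ler_wpM2l//.
by rewrite (le_trans (ler_normD _ _))// lerD// normr_le_hyp.
Qed.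

Lemma ramp_lip (a b : R) : `|ramp d a - ramp d b| <= `|a - b|.
Proof.
rewrite (_ : _ - _ = ((hyp d a - hyp d b) + (a - b)) / 2); last by rewrite /ramp; field.
rewrite normrM [X in _ * X]gtr0_norm ?invr_gt0// ler_pdivrMr// mulr_natr mulr2n.
by rewrite (le_trans (ler_normD _ _))// lerD2r hyp_lip.
Qed.

Lemma normr_div_hyp_le1 (t : R) : `|t / hyp d t| <= 1.
Proof.
by rewrite normrM normfV [X in _ / X]gtr0_norm ?hyp_gt0// ler_pdivrMr ?hyp_gt0// mul1r normr_le_hyp.
Qed.

Lemma ramp'_itv (t : R) : 0 <= ramp' d t <= 1.
Proof.
have := normr_div_hyp_le1 t; rewrite ler_norml => /andP[t1 t2].
by rewrite /ramp'; apply/andP; split; lra.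
Qed.

Lemma ramp'_lip (a b : R) : `|ramp' d a - ramp' d b| <= d^-1 * `|a - b|.
Proof.
have ha := hyp_neq0 d0 a; have hb := hyp_neq0 d0 b.
have ha0 := hyp_gt0 d0 a; have hb0 := hyp_gt0 d0 b.
(* In this factorization 1 / hyp(a) is at most 1 / d, b / hyp(b) is at most 1 in absolute value, and
   [hyp] is 1-Lipschitz. *)
have -> : ramp' d a - ramp' d b =
    (hyp d a)^-1 * (((a - b) + (b / hyp d b) * (hyp d b - hyp d a)) / 2).
  by rewrite /ramp'; field; rewrite ha hb.
rewrite normrM ler_pM//.
  by rewrite gtr0_norm ?invr_gt0// lef_pV2 ?posrE// ler_hyp_d.
rewrite normrM [X in _ * X]gtr0_norm ?invr_gt0// ler_pdivrMr// mulr_natr mulr2n.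
rewrite (le_trans (ler_normD _ _))// lerD2l normrM -[leRHS]mul1r ler_pM//.
  exact: normr_div_hyp_le1.
by rewrite distrC hyp_lip.
Qed.

Lemma ramp_pos_dist (t : R) : `|ramp d t - Num.max t 0| <= d.
Proof.
have h1 := normr_le_hyp t; have h2 := hyp_le_normrD t.
rewrite /ramp; have [t0|t0] := leP t 0.
  rewrite ler0_norm// in h1 h2; rewrite subr0 ler_norml; apply/andP; split; lra.
rewrite gtr0_norm// in h1 h2; rewrite ler_norml; apply/andP; split; lra.
Qed.

(** A bound independent of d, which serves as majorant in dominated convergence. *)
Lemma ramp_pos_dist_le (t : R) : `|ramp d t - Num.max t 0| <= `|2 * t|.
Proof.
rewrite (le_trans (ler_normB _ _))// [leRHS]normrM [`|2|]gtr0_norm// mulr_natl mulr2n lerD//.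
  by have := ramp_lip t 0; rewrite ramp0// !subr0.
by have [t0|t0] := leP t 0; rewrite ?normr0.
Qed.

Lemma ramp'_sg_dist (t : R) : `|ramp' d t - (Num.sg t + 1) / 2| <= d / `|t|.
Proof.
(* At t = 0 both terms equal 1/2, and the right side is 0 because 0^-1 = 0. *)
have [->|t0] := eqVneq t 0; first by rewrite /ramp' mul0r sgr0 subrr !normr0 invr0 mulr0.
have nt0 : 0 < `|t| by rewrite normr_gt0.
have h0 := hyp_gt0 d0 t; have hN := hyp_neq0 d0 t.
have -> : ramp' d t - (Num.sg t + 1) / 2 = - (Num.sg t * ((hyp d t - `|t|) / hyp d t) / 2).
  by rewrite /ramp' {1}(numEsg t); field.
rewrite normrN 2!normrM normr_sg t0 mul1r [X in _ * X]gtr0_norm ?invr_gt0//.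
have dt0 : 0 <= hyp d t - `|t| by rewrite subr_ge0 normr_le_hyp.
rewrite ger0_norm ?divr_ge0 ?(ltW h0)//.
have le1 : (hyp d t - `|t|) / hyp d t <= d / `|t|.
  rewrite ler_pM// ?invr_ge0 ?(ltW h0)//; first by rewrite lerBlDl hyp_le_normrD.
  by rewrite lef_pV2 ?posrE// normr_le_hyp.
rewrite (le_trans _ le1)// ler_pdivrMr// ler_peMr//; first by rewrite divr_ge0// ltW.
by rewrite ler1n.
Qed.

Lemma continuous_ramp : continuous (ramp d).
Proof.
move=> t; apply: differentiable_continuous; apply/derivable1_diffP.
exact: (@ex_derive _ _ _ _ _ _ _ (is_derive_ramp d0 t)).
Qed.

Lemma measurable_ramp : measurable_fun setT (ramp d).
Proof. by apply: continuous_measurable_fun; exact: continuous_ramp. Qed.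

Lemma measurable_ramp' : measurable_fun setT (ramp' d).
Proof.
apply: measurable_funM => //; apply: measurable_funD => //; apply: measurable_funM => //.
apply: continuous_measurable_fun => t.
apply: differentiable_continuous; apply/derivable1_diffP.
exact: (@ex_derive _ _ _ _ _ _ _ (is_derive_inv_hyp d0 t)).
Qed.

End ramp_estimates.

(** * The Sobolev norm compared with integrals of p-th powers *)

Section sobolev_norm_Lpow.
Context (R : realType) (n : nat) (p : R).
Context (p1 : 1 <= p).
Local Notation V := 'rV[R]_n.
Local Notation lambda := (lebesgue R n).

Let p0 : 0 < p. Proof. exact: lt_le_trans p1. Qed.

Lemma Lnorm_lt_Lpow (f : V -> R) (e : R) : 0 <= e ->
  (Lnorm lambda p%:E (EFin \o f) < e%:E)%E -> (Lpow lambda p f <= (e `^ p)%:E)%E.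
Proof.
move=> e0 /ltW fe; rewrite -poweR_EFin.
rewrite [leLHS](_ : _ = Lnorm lambda p%:E (EFin \o f) `^ p)%E; last first.
  by rewrite poweR_Lnorm ?gt_eqF.
by rewrite gt0_ler_poweR ?(ltW p0)// !in_itv/= ?Lnorm_ge0 ?lee_fin ?leey ?e0.
Qed.

Lemma Lpow_le_Lnorm (f : V -> R) (e : R) : 0 <= e ->
  (Lpow lambda p f <= (e `^ p)%:E)%E -> (Lnorm lambda p%:E (EFin \o f) <= e%:E)%E.
Proof.
move=> e0 fe; have pV0 : 0 <= p^-1 by rewrite invr_ge0 ltW.
have -> : Lnorm lambda p%:E (EFin \o f) = (Lpow lambda p f `^ p^-1)%E.
  have -> : Lpow lambda p f = (Lnorm lambda p%:E (EFin \o f) `^ p)%E.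
    by rewrite poweR_Lnorm ?gt_eqF.
  by rewrite -poweRrM mulfV ?gt_eqF// poweRe1// Lnorm_ge0.
have -> : e%:E = ((e `^ p)%:E `^ p^-1)%E.
  by rewrite poweR_EFin -powRrM mulfV ?gt_eqF// powRr1.
by rewrite gt0_ler_poweR// !in_itv/= ?Lpow_ge0 ?lee_fin ?leey ?powR_ge0.
Qed.

Lemma normr_coord_le_enorm (v : V) i : `|v ord0 i| <= enorm v.
Proof.
rewrite -sqrtr_sqr ler_wsqrtr// /dotv (bigD1 i)//= expr2 lerDl.
by apply: sumr_ge0 => j _; rewrite -expr2 sqr_ge0.
Qed.

(** The Euclidean norm is at most n times the sup norm, and the sup norm is attained at a
    coordinate, whose p-th power is one term of the sum. *)
Lemma enorm_powR_le (v : V) :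
  enorm v `^ p <= n%:R `^ p * \sum_(i < n) `|v ord0 i| `^ p.
Proof.
have venorm : enorm v <= n%:R * `|v|.
  have nv0 : 0 <= n%:R * `|v| by rewrite mulr_ge0.
  rewrite -[leRHS]ger0_norm// -sqrtr_sqr ler_wsqrtr// /dotv.
  rewrite (@le_trans _ _ (\sum_(i < n) `|v| ^+ 2))//.
    apply: ler_sum => i _; rewrite -expr2 -[leLHS]real_normK ?num_real//.
    by rewrite lerXn2r ?nnegrE// normr_coord_le.
  rewrite sumr_const card_ord -[leLHS]mulr_natl exprMn ler_wpM2r ?sqr_ge0//.
  by rewrite -natrX ler_nat; case: (n) => // k; rewrite expnS expn1 leq_pmulr.
rewrite (@le_trans _ _ ((n%:R * `|v|) `^ p))//.
  by rewrite ge0_ler_powR ?nnegrE ?mulr_ge0 ?sqrtr_ge0 ?(ltW p0).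
rewrite powRM// ler_wpM2l ?powR_ge0//.
have [v0|/mx_norm_neq0[[i j] /= vij]] := eqVneq (mx_norm v) 0.
  rewrite (_ : `|v| = 0)// powR0 ?gt_eqF//.
  by apply: sumr_ge0 => j _; rewrite powR_ge0.
rewrite (_ : `|v| = `|v i j|)// ord1 (bigD1 j)//= lerDl.
by apply: sumr_ge0 => k _; rewrite powR_ge0.
Qed.

Lemma W01p_approx (f : wdiff R n) : W01p p f -> approx p f (wgrad f).
Proof.
move=> Wf e e0; have e20 : 0 < e / 2 by rewrite divr_gt0.
(* Norms below (e/2)^(1/p) give p-th powers at most e/2; the halving restores the strict
   inequality. *)
have eps0 : 0 < (e / 2) `^ p^-1 by rewrite powR_gt0.
have epsE : ((e / 2) `^ p^-1) `^ p = e / 2.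
  by rewrite -powRrM mulVf ?gt_eqF// powRr1// ltW.
have elt : ((e / 2)%:E < e%:E)%E by rewrite lte_fin ltr_pdivrMr// ltr_pMr// ltr1n.
have [phi Cphi phieps] := Wf _ eps0; exists phi => //; split=> [|i].
  rewrite (le_lt_trans _ elt)// -epsE; apply: Lnorm_lt_Lpow; first exact: ltW.
  by rewrite (le_lt_trans _ phieps)// leeDl// Lnorm_ge0.
rewrite (le_lt_trans _ elt)//.
apply: (@le_trans _ _ (Lpow lambda p (fun x => enorm ((wgrad f \- grad phi) x)))).
  apply: le_Lpow; first exact: ltW.
  move=> x; rewrite [leRHS]ger0_norm ?sqrtr_ge0//.
  by have := normr_coord_le_enorm ((wgrad f \- grad phi) x) i; rewrite !mxE.
rewrite -epsE; apply: Lnorm_lt_Lpow; first exact: ltW.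
by rewrite (le_lt_trans _ phieps)// leeDr// Lnorm_ge0.
Qed.

Lemma approx_W01p (f : wdiff R n) : (forall i, measurable_fun setT (fun x => wgrad f x ord0 i)) ->
  approx p f (wgrad f) -> W01p p f.
Proof.
move=> mG fG eps eps0; have e40 : 0 < eps / 4 by rewrite divr_gt0.
have C0 : 0 <= n%:R `^ p * n%:R :> R by rewrite mulr_ge0// powR_ge0.
have C10 : 0 < 1 + n%:R `^ p * n%:R :> R by rewrite ltr_wpDr.
(* With this e, both e and n^p n e are at most (eps/4)^p, so the function and the gradient
   contribute at most eps/4 each. *)
pose e := (eps / 4) `^ p / (1 + n%:R `^ p * n%:R).
have e0 : 0 < e by rewrite divr_gt0// powR_gt0.
have [phi Cphi [fphi Gphi]] := fG _ e0; exists phi => //.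
have sub : ((eps / 4 + eps / 4)%:E < eps%:E)%E by rewrite lte_fin; lra.
apply: le_lt_trans sub; rewrite EFinD; apply: leeD.
  apply: Lpow_le_Lnorm; first exact: ltW.
  by rewrite (le_trans (ltW fphi))// lee_fin /e ler_pdivrMr// ler_peMr ?powR_ge0// lerDl.
apply: (@Lpow_le_Lnorm (fun x => enorm ((wgrad f \- grad phi) x))); first exact: ltW.
have mB i : measurable_fun setT (fun x => wgrad f x ord0 i - partial i phi x).
  apply: measurable_funB => //; apply: measurable_continuous_mx.
  exact: Cc_infty_continuous_partial.
apply: (@le_trans _ _ (\int[lambda]_x ((n%:R `^ p)%:E *
    \sum_(i < n) (`|wgrad f x ord0 i - partial i phi x| `^ p)%:E)))%E.
  apply: ge0_le_integral_sup => x _; first by rewrite lee_fin powR_ge0.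
  rewrite sumEFin -EFinM lee_fin ger0_norm ?sqrtr_ge0//.
  apply: le_trans (enorm_powR_le _) _; rewrite ler_wpM2l ?powR_ge0//.
  by apply: ler_sum => i _; rewrite !mxE.
rewrite ge0_integralZl_EFin ?powR_ge0//; last 2 first.
- by move=> x _; apply: sume_ge0 => i _; rewrite lee_fin powR_ge0.
- by apply: emeasurable_sum => i; exact: measurable_Lpow.
rewrite ge0_integral_sum//; last by move=> i; exact: measurable_Lpow.
apply: (@le_trans _ _ ((n%:R `^ p)%:E * \sum_(i < n) e%:E))%E.
  by rewrite lee_wpmul2l ?lee_fin ?powR_ge0//; apply: lee_sum => i _; exact: ltW (Gphi i).
rewrite sumEFin -EFinM lee_fin sumr_const card_ord -[e *+ _]mulr_natl mulrA.
by rewrite /e mulrCA ler_piMr ?powR_ge0// ler_pdivrMr// mul1r lerDr.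
Qed.

End sobolev_norm_Lpow.

(** * The positive part of a Sobolev function *)

Section positive_part.
Context (R : realType) (n : nat) (p : R).
Context (p1 : 1 <= p).
Local Notation V := 'rV[R]_n.
Local Notation lambda := (lebesgue R n).
Implicit Types (F : V -> R) (G : V -> V).

Let p0 : 0 < p. Proof. exact: lt_le_trans p1. Qed.

(* The factor 1/2 on the set where F vanishes is the limit of [ramp'] at 0;
   it is harmless because only a factor between 0 and 1 is needed. *)
Definition pos_fun F (x : V) : R := Num.max (F x) 0.
Definition pos_grad F G (x : V) : V := ((Num.sg (F x) + 1) / 2) *: G x.

Lemma sg_weight_itv (t : R) : 0 <= (Num.sg t + 1) / 2 <= 1.
Proof.
have := normr_sg t; have [->|t0] := eqVneq t 0 => /= st.
  by rewrite sgr0; apply/andP; split; lra.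
have : `|Num.sg t| <= 1 by rewrite st.
by rewrite ler_norml => /andP[? ?]; apply/andP; split; lra.
Qed.

Lemma measurable_sg : measurable_fun setT (Num.sg : R -> R).
Proof.
apply: nondecreasing_measurable => // x y xy.
by case: (sgrP x); case: (sgrP y) => //; lra.
Qed.

Lemma measurable_pos_fun F : measurable_fun setT F -> measurable_fun setT (pos_fun F).
Proof. by move=> mF; apply: measurable_maxr. Qed.

Lemma measurable_pos_grad F G i : measurable_fun setT F ->
  measurable_fun setT (fun x => G x ord0 i) ->
  measurable_fun setT (fun x => pos_grad F G x ord0 i).
Proof.
move=> mF mG; under eq_fun do rewrite mxE; apply: measurable_funM => //.
apply: measurable_funM => //; apply: measurable_funD => //.
exact: measurableT_comp measurable_sg mF.
Qed.

Lemma LpowD_lt (f g : V -> R) (a b : R) :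
  measurable_fun setT f -> measurable_fun setT g ->
  (Lpow lambda p f < a%:E)%E -> (Lpow lambda p g < b%:E)%E ->
  (Lpow lambda p (f \+ g)%R < (2 `^ p * (a + b))%:E)%E.
Proof.
move=> mf mg fa gb; apply: le_lt_trans (LpowD lambda (ltW p0) mf mg) _.
rewrite EFinM lte_pmul2l// ?lte_fin ?powR_gt0// EFinD.
apply: lteD => //.
Qed.

(** The ramps converge uniformly to the positive part at rate d = 1/(k+1), and |2 F| is a
    majorant. *)
Lemma near_ramp_pos F : measurable_fun setT F -> (Lpow lambda p F < +oo)%E ->
  forall e, 0 < e -> \forall k \near \oo,
  (Lpow lambda p (pos_fun F \- (ramp k.+1%:R^-1 \o F))%R < e%:E)%E.
Proof.
move=> mF Foo.
have d0 k : (0 : R) < k.+1%:R^-1 by rewrite invr_gt0.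
have mh k : measurable_fun setT (pos_fun F \- (ramp k.+1%:R^-1 \o F)).
  apply: measurable_funB; first exact: measurable_pos_fun.
  exact: measurableT_comp (measurable_ramp (d0 k)) mF.
have m2F : measurable_fun setT (fun x => 2 * F x) by exact: measurable_funM.
have h0 x : (pos_fun F \- (ramp k.+1%:R^-1 \o F)) x @[k --> \oo] --> 0.
  apply/cvgrPdist_lt => e e0.
  have := near_infty_natSinv_lt (PosNum e0); apply: filterS => k ke.
  rewrite sub0r normrN distrC (le_lt_trans _ ke)//; exact: ramp_pos_dist.
have hF k x : `|(pos_fun F \- (ramp k.+1%:R^-1 \o F)) x| <= `|2 * F x|.
  by rewrite /= distrC; exact: ramp_pos_dist_le.
apply: (Lpow_dominated p0 mh m2F h0 hF).
by rewrite LpowZ ?(ltW p0)// lte_mul_pinfty// lee_fin powR_ge0.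
Qed.

(** Both weights lie in [0, 1], so |g| is a majorant. Where F vanishes the two weights are both 1/2
    for every k; elsewhere they differ by at most d / |F|. *)
Lemma near_ramp_pos_grad F (g : V -> R) : measurable_fun setT F ->
  measurable_fun setT g -> (Lpow lambda p g < +oo)%E ->
  forall e, 0 < e -> \forall k \near \oo,
  (Lpow lambda p (fun x => ((Num.sg (F x) + 1) / 2 - ramp' k.+1%:R^-1 (F x)) * g x)%R
   < e%:E)%E.
Proof.
move=> mF mg goo.
have d0 k : (0 : R) < k.+1%:R^-1 by rewrite invr_gt0.
apply: (@Lpow_dominated _ _ _ _ p _ g) => //.
- move=> k; apply: measurable_funM => //; apply: measurable_funB.
    apply: measurable_funM => //; apply: measurable_funD => //.
    exact: measurableT_comp measurable_sg mF.
  exact: measurableT_comp (measurable_ramp' (d0 k)) mF.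
- move=> x; have [Fx0|Fx0] := eqVneq (F x) 0.
    rewrite (_ : (fun k => _) = cst 0); first exact: cvg_cst.
    by apply/funext => k; rewrite Fx0 /ramp' mul0r sgr0 subrr mul0r.
  rewrite -(mul0r (g x)); apply: cvgMl; apply/cvgrPdist_lt => e e0.
  have eF0 : 0 < e * `|F x| by rewrite mulr_gt0// normr_gt0.
  have := near_infty_natSinv_lt (PosNum eF0); apply: filterS => k /= ke.
  rewrite sub0r normrN distrC (le_lt_trans (ramp'_sg_dist (d0 k) _))//.
  by rewrite ltr_pdivrMr// normr_gt0.
- move=> k x; rewrite normrM ler_piMl//.
  have /andP[? ?] := sg_weight_itv (F x); have /andP[? ?] := ramp'_itv (d0 k) (F x).
  by rewrite ler_norml; apply/andP; split; lra.
Qed.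

Lemma approx_pos F G : measurable_fun setT F ->
  (forall i, measurable_fun setT (fun x => G x ord0 i)) ->
  approx p F G -> approx p (pos_fun F) (pos_grad F G).
Proof.
move=> mF mG FG e e0.
have Foo := approx_Lpow_lty p1 mF FG.
have Goo i := approx_grad_Lpow_lty p1 (mG i) FG.
pose K : R := 2 `^ p; have K0 : 0 < K by rewrite powR_gt0.
have K1 : 1 <= K.
  by have := @ler_powR R 2 (ler1n _ 2) _ _ (ltW p0); rewrite powRr0.
(* The gradient error is a sum of four terms below eta, added in two rounds that each cost a factor
   K: the bound is 4 K^2 eta = e. *)
pose eta := e / (4 * K ^+ 2).
have eta0 : 0 < eta by rewrite divr_gt0// mulr_gt0// exprn_gt0.
have [psi Cpsi [_ Gpsi]] := FG _ eta0.
have cdpsi i : continuous (partial i psi) := Cc_infty_continuous_partial Cpsi.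
have [M psi0] := Cc_infty_cube Cpsi.
have /choice[C HC] i : exists C, 0 < C /\ forall x, `|partial i psi x| <= C.
  have [C C0 HC] := continuous_cube_bounded (cdpsi i) (partial_eq0 i psi0).
  by exists C.
(* A single bound for all the partial derivatives of psi. *)
pose C' := \sum_(i < n) C i.
have psiC i x : `|partial i psi x| <= C'.
  rewrite (le_trans ((HC i).2 x))// /C' (bigD1 i)//= lerDl.
  by apply: sumr_ge0 => j _; rewrite ltW// (HC j).1.
have C'0 : 0 <= C' by apply: sumr_ge0 => j _; rewrite ltW// (HC j).1.
(* The conditions hold for all large k and the coordinates are finite in number, so one k serves for
   all of them. *)
have [k [Fk Gk]] : exists k,
    (Lpow lambda p (pos_fun F \- (ramp k.+1%:R^-1 \o F))%R < eta%:E)%E /\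
    forall i, (Lpow lambda p (fun x => ((Num.sg (F x) + 1) / 2 - ramp' k.+1%:R^-1 (F x))
      * G x ord0 i)%R < eta%:E)%E.
  have nF := near_ramp_pos mF Foo eta0.
  have nG := filter_forall _ (fun i => near_ramp_pos_grad mF (mG i) (Goo i) eta0).
  near \oo => k; exists k; split; near: k; [exact: nF|exact: nG].
set d : R := k.+1%:R^-1; have d0 : 0 < d by rewrite invr_gt0.
(* B is the factor by which the error of phi is magnified in the third term: 1/d is a Lipschitz
   constant of [ramp'], and C' bounds the derivatives of psi. Since d and psi are already fixed, phi
   can be taken with precision eta / (B + 1). *)
pose B := (d^-1 * C') `^ p.
have B0 : 0 <= B by rewrite powR_ge0.
have B10 : 0 < B + 1 by rewrite ltr_wpDl.
have [phi Cphi [Fphi Gphi]] := FG (eta / (B + 1)) (divr_gt0 eta0 B10).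
have eta'_le : eta / (B + 1) <= eta by rewrite ler_pdivrMr// ler_peMr ?(ltW eta0)// lerDr.
have mphi := measurable_continuous_mx (Cc_infty_continuous Cphi).
have mdphi i : measurable_fun setT (partial i phi).
  by apply: measurable_continuous_mx; exact: Cc_infty_continuous_partial.
have mdpsi i : measurable_fun setT (partial i psi).
  exact: measurable_continuous_mx (cdpsi i).
have mrF := measurableT_comp (measurable_ramp d0) mF.
have mrphi := measurableT_comp (measurable_ramp d0) mphi.
have mr'F := measurableT_comp (measurable_ramp' d0) mF.
have mr'phi := measurableT_comp (measurable_ramp' d0) mphi.
have Fphi' : (Lpow lambda p (F \- phi)%R < eta%:E)%E.
  by rewrite (lt_le_trans Fphi)// lee_fin.
exists (ramp d \o phi); first exact: Cc_infty_ramp.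
split.
  rewrite (_ : _ \- _ = (pos_fun F \- (ramp d \o F)) \+ ((ramp d \o F) \- (ramp d \o phi))).
    apply: (@lt_le_trans _ _ (K * (eta + eta))%:E).
      have mA : measurable_fun setT (pos_fun F \- (ramp d \o F)).
        by apply: measurable_funB => //; exact: measurable_pos_fun.
      have mB : measurable_fun setT ((ramp d \o F) \- (ramp d \o phi)).
        exact: measurable_funB.
      have rFphi : (Lpow lambda p ((ramp d \o F) \- (ramp d \o phi))%R < eta%:E)%E.
        apply: le_lt_trans Fphi'; apply: le_Lpow; first exact: ltW.
        by move=> x; exact: ramp_lip.
      exact: LpowD_lt mA mB Fk rFphi.
    rewrite lee_fin /eta (_ : K * _ = e * (2 * K)^-1); last by field; rewrite gt_eqF.
    by rewrite ler_piMr ?(ltW e0)// invf_le1 ?mulr_gt0//; lra.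
  by apply/funext => x /=; rewrite addrA subrK.
move=> i.
have chain x : partial i (ramp d \o phi) x = ramp' d (phi x) * partial i phi x.
  apply: partial_comp1; last exact: is_derive_ramp.
  by case: Cphi => /(_ 1%N)/Ck_derivable.
pose h1 x := ((Num.sg (F x) + 1) / 2 - ramp' d (F x)) * G x ord0 i.
pose h2 x := (ramp' d (F x) - ramp' d (phi x)) * (G x ord0 i - partial i psi x).
pose h3 x := (ramp' d (F x) - ramp' d (phi x)) * partial i psi x.
pose h4 x := ramp' d (phi x) * (G x ord0 i - partial i phi x).
rewrite (_ : (fun x => _) = (h1 \+ h2) \+ (h3 \+ h4)); last first.
  by apply/funext => x; rewrite chain mxE /h1 /h2 /h3 /h4 /=; ring.
have mh1 : measurable_fun setT h1.
  apply: measurable_funM => //; apply: measurable_funB => //.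
  apply: measurable_funM => //; apply: measurable_funD => //.
  exact: measurableT_comp measurable_sg mF.
have mh2 : measurable_fun setT h2 by apply: measurable_funM; exact: measurable_funB.
have mh3 : measurable_fun setT h3 by apply: measurable_funM => //; exact: measurable_funB.
have mh4 : measurable_fun setT h4 by apply: measurable_funM => //; exact: measurable_funB.
have h2_lt : (Lpow lambda p h2 < eta%:E)%E.
  apply: le_lt_trans (Gpsi i); apply: le_Lpow; first exact: ltW.
  move=> x; rewrite /h2 normrM ler_piMl//.
  have /andP[? ?] := ramp'_itv d0 (phi x); have /andP[? ?] := ramp'_itv d0 (F x).
  by rewrite ler_norml; apply/andP; split; lra.
have h4_lt : (Lpow lambda p h4 < eta%:E)%E.
  apply: (@lt_le_trans _ _ (eta / (B + 1))%:E); last by rewrite lee_fin.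
  apply: le_lt_trans (Gphi i); apply: le_Lpow; first exact: ltW.
  move=> x; rewrite /h4 normrM ler_piMl//.
  have /andP[? ?] := ramp'_itv d0 (phi x).
  by rewrite ger0_norm.
have h3_lt : (Lpow lambda p h3 < eta%:E)%E.
  have mFphi : measurable_fun setT (F \- phi) by exact: measurable_funB.
  have dC0 : 0 <= d^-1 * C' by rewrite mulr_ge0// invr_ge0 ltW.
  apply: (@le_lt_trans _ _ (Lpow lambda p (fun x => (d^-1 * C') * (F \- phi) x))).
    apply: le_Lpow; first exact: ltW.
    move=> x; rewrite /h3 !normrM (ger0_norm C'0) mulrAC ler_pM//.
    rewrite [X in _ <= X * _]gtr0_norm ?invr_gt0//; exact: ramp'_lip.
  rewrite LpowZ ?(ltW p0)// ger0_norm//.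
  apply: (@le_lt_trans _ _ (B * (eta / (B + 1)))%:E).
    by rewrite EFinM lee_wpmul2l ?lee_fin// ltW.
  by rewrite lte_fin mulrCA gtr_pMr// ltr_pdivrMr// mul1r ltrDl.
have h12 := LpowD_lt mh1 mh2 (Gk i) h2_lt.
have h34 := LpowD_lt mh3 mh4 h3_lt h4_lt.
have mh12 : measurable_fun setT (h1 \+ h2) by exact: measurable_funD.
have mh34 : measurable_fun setT (h3 \+ h4) by exact: measurable_funD.
apply: lt_le_trans (LpowD_lt mh12 mh34 h12 h34) _.
rewrite lee_fin -/K /eta (_ : K * _ = e)//.
by field; rewrite gt_eqF.
Unshelve. all: by end_near. Qed.

Lemma pos_weak_gradient F G : weak_gradient F G -> approx p F G ->
  weak_gradient (pos_fun F) (pos_grad F G).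
Proof.
move=> [lF lG _] FG.
have mF := locally_integrable_measurable lF.
have mG i := locally_integrable_measurable (lG i).
apply: (approx_weak_gradient p1); last exact: approx_pos.
- exact: measurable_pos_fun.
- by move=> i; exact: measurable_pos_grad.
Qed.

End positive_part.

(** * Monotonicity of the energy and admissibility of the positive part *)

Section energy.
Context (R : realType) (n : nat).
Local Notation V := 'rV[R]_n.
Local Notation lambda := (lebesgue R n).

Lemma dotvZr (c : R) (u v : V) : dotv u (c *: v) = c * dotv u v.
Proof. by rewrite /dotv mulr_sumr; apply: eq_bigr => i _; rewrite mxE mulrCA. Qed.

Lemma phi_tau_ge0 (p tau t : R) : 0 <= phi_tau p tau t.
Proof. by rewrite addr_ge0// mulr_ge0 ?powR_ge0// le_max lexx orbT. Qed.

Lemma phi_tauZ (p tau c t : R) : 0 <= c -> phi_tau p tau (c * t) = c * phi_tau p tau t.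
Proof.
move=> c0; have maxZ s : Num.max (c * s) 0 = c * Num.max s 0.
  by rewrite maxr_pMr// mulr0.
by rewrite /phi_tau -mulrN !maxZ; ring.
Qed.

Lemma poweRV_ge0 (x : \bar R) (s : R) : (0 <= poweRV x s)%E.
Proof. by rewrite /poweRV inve_ge0 poweR_ge0. Qed.

Lemma le_poweRV (x y : \bar R) (s : R) : 0 <= s -> (0 <= x)%E -> (x <= y)%E ->
  (poweRV y s <= poweRV x s)%E.
Proof.
move=> s0 x0 xy; rewrite /poweRV lee_pV2 ?inE ?poweR_ge0//.
by rewrite gt0_ler_poweR// in_itv/= ?leey ?andbT// (le_trans x0).
Qed.

(** By positive homogeneity of [phi_tau], scaling the gradient by c in [0, 1] lowers the inner
    integrand pointwise. The two negative powers each reverse the order, so the energy is lowered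
    too. *)
Lemma le_calH (sigma : probability V R) (p tau : R) (f g : wdiff R n) : 1 <= p ->
  (forall x, exists2 c : R, 0 <= c <= 1 & wgrad f x = c *: wgrad g x) ->
  (calH sigma p tau f <= calH sigma p tau g)%E.
Proof.
move=> p1 fg; have p0 : 0 <= p by rewrite (le_trans _ p1).
rewrite /calH; apply: le_poweRV; first by rewrite divr_ge0.
  by apply: integral_ge0 => u _; exact: poweRV_ge0.
apply: ge0_le_integral_sup => u _; first exact: poweRV_ge0.
apply: le_poweRV; first by rewrite divr_ge0.
  by apply: integral_ge0 => x _; rewrite lee_fin powR_ge0.
apply: ge0_le_integral_sup => x _; rewrite lee_fin ?powR_ge0//.
have [c /andP[c0 c1] ->] := fg x; rewrite dotvZr phi_tauZ//.
by rewrite ge0_ler_powR ?nnegrE ?mulr_ge0 ?phi_tau_ge0// ler_piMl ?phi_tau_ge0.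
Qed.

(** Elements of D(K) may be negative off K, which the positive part corrects while leaving values at
    least 1 unchanged. *)
Lemma pos_in_calE (p : R) (K : set V) (f : wdiff R n) : 1 <= p -> calD p K f ->
  exists2 h : wdiff R n, calE p K h &
    wgrad h = pos_grad f (wgrad f).
Proof.
move=> p1 [Wf fK]; have fG := W01p_approx p1 Wf.
have [lf lg _] := wdiffP f.
have mf := locally_integrable_measurable lf.
have mg i := locally_integrable_measurable (lg i).
exists (WDiff (pos_weak_gradient p1 (wdiffP f) fG)) => //; split.
  apply: approx_W01p => // [i|]; first exact: measurable_pos_grad.
  exact: approx_pos.
apply: filterS fK => x fx; rewrite /= /pos_fun indicE.
have [/set_mem/fx fx1|_] := boolP (x \in K); rewrite le_max ?lexx ?orbT//.
by apply/orP; left.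
Qed.

End energy.

(** * Equality of the two infima *)

Unset Implicit Arguments.
Set Strict Implicit.

Theorem theorem3p2 (R : realType) (n : nat) (p tau : R)
    (sigma : probability 'rV[R]_n R) (K : set 'rV[R]_n)
    (hn : (2 <= n)%N) (hp : 1 <= p < n%:R) (htau : -1 <= tau <= 1)
    (hsigma : rotation_invariant_sphere sigma) (hK : compact K) :
  capacity sigma p tau K = ereal_inf [set calH sigma p tau f | f in calD p K].
Proof.
have p1 : 1 <= p by case/andP: hp.
apply/eqP; rewrite eq_le; apply/andP; split.
  (* Each f in D(K) has at least the energy of its positive part h, which competes in the infimum
     over E(K). *)
  apply: le_ereal_inf_tmp => _ [f fD <-]; have [h hE hgrad] := pos_in_calE p1 fD.
  apply: (@le_trans _ _ (calH sigma p tau h)); first by apply: ereal_inf_lbound; exists h.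
  apply: le_calH => // x; exists ((Num.sg (f x) + 1) / 2); first exact: sg_weight_itv.
  by rewrite hgrad.
(* Conversely E(K) is contained in D(K), the indicator being 1 on K. *)
apply: ereal_inf_le_tmp => _ [f [Wf fK] <-]; exists f => //; split => //.
by apply: filterS fK => x fx Kx; move: fx; rewrite indicE mem_set.
Qed.
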